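(* Let $d\geqslant 1$ and let $f$ be a real-valued function in $L^1(\mathbb{R}^d)$ such that $$u(x) := f(x) - f\star f(x) \geqslant 0$$ for almost every $x\in\mathbb{R}^d$. Then $\int_{\mathbb{R}^d} f(x)\,dx \leqslant \tfrac12$, and $f$ is given by the series $$f = \frac12\sum_{n=1}^\infty c_n 4^n (\star^n u),$$ which converges in $L^1(\mathbb{R}^d)$, where the $c_n\geqslant 0$ are the Taylor coefficients in the expansion $$\sqrt{1-x} = 1-\sum_{n=1}^\infty c_n x^n, \qquad c_n = \frac{(2n-3)!!}{2^n n!},$$ and $c_n$ is asymptotic to a positive constant times $n^{-3/2}$ as $n\to\infty$. In particular, $f\geqslant 0$ almost everywhere. Moreover, if $u\geqslant 0$ is any integrable function on $\mathbb{R}^d$ with $\int_{\mathbb{R}^d} u(x)\,dx\leqslant \tfrac14$, then the sum $\frac12\sum_{n=1}^\infty c_n 4^n(\star^n u)$ defines an integrable function $f$ that satisfies $f - f\star f = u \geqslant 0$ almost everywhere, and $\int_{\mathbb{R}^d} f(x)\,dx = \tfrac12$ if and only if $\int_{\mathbb{R}^d}u(x)\,dx = \tfrac14$.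
   Context: For $f\in L^1(\mathbb{R}^d)$, $f\star f(x) = \int_{\mathbb{R}^d} f(x-y)f(y)\,dy$ denotes the convolution of $f$ with itself. $\star^n u$ denotes the $n$-fold convolution of $u$ with itself: $\star^1 u = u$ and $\star^{n+1}u = u\star(\star^n u)$. The double factorial convention is $(-1)!!=1$, so $c_1=\tfrac12$. Functions in $L^1(\mathbb{R}^d)$ are identified when equal almost everywhere. *)

(* Defs.v *)
From HB Require Import structures.
From mathcomp Require Import all_boot all_order all_algebra.
From mathcomp Require Import all_classical all_reals all_analysis.

Set Implicit Arguments.
Unset Strict Implicit.
Unset Printing Implicit Defensive.
Import Order.TTheory GRing.Theory Num.Theory.
Import numFieldNormedType.Exports.

Local Open Scope classical_set_scope.
Local Open Scope ring_scope.

(* The library registers this fact only behind an instance that inference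
   resolves to products of subprobabilities. *)
Lemma product_measure1_sigma_finite (d1 d2 : measure_display)
    (T1 : measurableType d1) (T2 : measurableType d2) (R : realType)
    (m1 : {sigma_finite_measure set T1 -> \bar R})
    (m2 : {sigma_finite_measure set T2 -> \bar R}) :
  sigma_finite setT (m1 \x m2)%E.
Proof.
have /sigma_finiteP[F [TF ndF Foo]] := sigma_finiteT m1.
have /sigma_finiteP[G [TG ndG Goo]] := sigma_finiteT m2.
exists (fun n => F n `*` G n) => [|k].
  rewrite -setXTT TF TG; apply/seteqP; split => [[x y] /=|[x y] [n _ []]].
    move=> [[n _ Fnx] [k _ Gky]]; exists (maxn n k) => //; split.
    - by move: x Fnx; exact/subsetPset/ndF/leq_maxl.
    - by move: y Gky; exact/subsetPset/ndG/leq_maxr.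
  by split; exists n.
have [mF Fk] := Foo k; have [mG Gk] := Goo k.
split; first exact: measurableX.
by rewrite product_measure1E// lte_mul_pinfty// ge0_fin_numE.
Qed.

Section power_measure.
Context (dT : measure_display) (T : measurableType dT) (R : realType).

Definition tcons (n : nat) (p : T * n.-tuple T) : n.+1.-tuple T :=
  [the n.+1.-tuple T of p.1 :: p.2].

Lemma measurable_tcons n : measurable_fun setT (@tcons n).
Proof. exact: (measurable_cons measurable_fst measurable_snd). Qed.

Definition tuncons (n : nat) (t : n.+1.-tuple T) : T * n.-tuple T :=
  (thead t, [tuple of behead t]).

Lemma measurable_tuncons n : measurable_fun setT (@tuncons n).
Proof.
apply: measurable_fun_pair; first exact: measurable_tnth.
exact: measurable_behead.
Qed.

Lemma tconsK n : cancel (@tcons n) (@tuncons n).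
Proof. by case=> x t; congr pair; apply: val_inj. Qed.

Section step.
Variables (m : {sigma_finite_measure set T -> \bar R}) (n : nat).
Variable mn : {sigma_finite_measure set (n.-tuple T) -> \bar R}.

Definition tcons_measure : set (n.+1.-tuple T) -> \bar R :=
  pushforward (m \x mn)%E (@tcons n).

Let tcons_pushforward : {measure set (n.+1.-tuple T) -> \bar R} :=
  measure_function_pushforward__canonical__measure_function_Measure
    (m \x mn)%E (@measurable_tcons n).

HB.instance Definition _ := isMeasure.Build _ _ _ tcons_measure
  (measure0 tcons_pushforward) (measure_ge0 tcons_pushforward)
  (@measure_semi_sigma_additive _ _ _ tcons_pushforward).

Let tcons_measure_sigma_finite : sigma_finite setT tcons_measure.
Proof.
have [F FT Foo] := product_measure1_sigma_finite m mn.
exists (fun i => @tuncons n @^-1` F i) => [|i].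
  by rewrite -preimage_bigcup -FT preimage_setT.
have [mF Fi] := Foo i; split.
  by rewrite -[X in measurable X]setTI; exact: measurable_tuncons.
rewrite /tcons_measure /pushforward -comp_preimage.
by rewrite (_ : _ \o _ = id)//; apply/funext => p /=; rewrite tconsK.
Qed.

HB.instance Definition _ := @Measure_isSigmaFinite.Build _ _ _ tcons_measure
  tcons_measure_sigma_finite.

End step.

Fixpoint power_measure (m : {sigma_finite_measure set T -> \bar R}) (n : nat) :
    {sigma_finite_measure set (n.-tuple T) -> \bar R} :=
  match n with
  | 0 => \d_[tuple of [::]]
  | n'.+1 => tcons_measure m (power_measure m n')
  end.

(* Characterizes the power measure: boxes generate the sigma-algebra. *)
Lemma power_measure_box (m : {sigma_finite_measure set T -> \bar R}) (n : nat)
    (A : 'I_n -> set T) : (forall i, measurable (A i)) ->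
  power_measure m n [set t | forall i, A i (tnth t i)] = (\prod_i m (A i))%E.
Proof.
elim: n A => [A _|n IH A mA] /=.
  rewrite big_ord0 diracE mem_set// => -[]//.
rewrite big_ord_recl -IH// /tcons_measure /pushforward.
rewrite -product_measure1E//.
  congr product_measure1; apply/seteqP; split => [[x t] /= xt|[x t] [/= x0 tA] i].
    split => [|i]; first exact: (xt ord0).
    by have := xt (lift ord0 i); rewrite tnthS.
  by case: (unliftP ord0 i) => [j ->|-> //]; rewrite tnthS.
rewrite (_ : mkset _ =
    \bigcap_(i in [set: 'I_n]) ((fun t => tnth t i) @^-1` A (lift ord0 i))).
  apply: fin_bigcap_measurable => // i _; rewrite -[X in measurable X]setTI.
  exact: measurable_tnth.
by apply/seteqP; split => t /= tA i => [_|]; [exact: tA|exact: (tA i Logic.I)].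
Qed.

End power_measure.

(* R^d, with the product (i.e. Borel) sigma-algebra of the tuple type. *)
Notation Rvec R d := (d.-tuple (measurableTypeR R)).

Definition lebesgue_Rvec (R : realType) (d : nat) :
    {sigma_finite_measure set (Rvec R d) -> \bar R} :=
  power_measure (@lebesgue_measure R) d.

Section convolution_powers.
Variables (R : realType) (d : nat).
Implicit Types (f g u : Rvec R d -> R) (x y : Rvec R d).

Definition vsub x y : Rvec R d := [tuple (tnth x i - tnth y i : R) | i < d].

(* `Rintegral` is total; for integrable f and g the integrand is integrable
   for almost every x, so the convolution is meaningful almost everywhere. *)
Definition convolution f g x : R :=
  \int[lebesgue_Rvec R d]_y (f (vsub x y) * g y).

(* iter_convolution n u is the n-fold convolution for n >= 1;
   iter_convolution 0 u = u is never used. *)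
Definition iter_convolution n u : Rvec R d -> R := iter n.-1 (convolution u) u.

Definition L1 f : Prop :=
  (lebesgue_Rvec R d).-integrable setT (EFin \o f).

Definition L1_cvg (F : nat -> Rvec R d -> R) f : Prop :=
  [/\ forall N, L1 (F N), L1 f &
    Lnorm (lebesgue_Rvec R d) 1%E (EFin \o (F N \- f)) @[N --> \oo] --> 0%E].

End convolution_powers.

Fixpoint double_fact (n : nat) : nat :=
  if n is m.+2 then (n * double_fact m)%N else 1%N.

(* Extends n!! to (-1)!! = 1; its value at other negative integers is irrelevant. *)
Definition double_factz (z : int) : nat :=
  if z is Posz n then double_fact n else 1%N.

Definition sqrt_coef (R : realType) (n : nat) : R :=
  (double_factz (2 * n%:Z - 3))%:R / (2 ^+ n * n`!%:R).

Definition sqrt_series (R : realType) (d : nat) (u : Rvec R d -> R) (N : nat)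
    (x : Rvec R d) : R :=
  2^-1 * \sum_(1 <= n < N.+1) sqrt_coef R n * 4 ^+ n * iter_convolution n u x.

(* Main.v *)
Require Import Defs.
From mathcomp Require Import all_boot all_order all_algebra.
From mathcomp Require Import all_classical all_reals all_analysis.
From mathcomp Require Import measurable_realfun.
From mathcomp Require Import complex.
From mathcomp Require Import ring lra zify.
Set Implicit Arguments.
Unset Strict Implicit.
Unset Printing Implicit Defensive.
Import Order.TTheory GRing.Theory Num.Theory.
Import numFieldNormedType.Exports.
Local Open Scope classical_set_scope.
Local Open Scope ring_scope.

(* Write f^ for the Fourier transform and * for the convolution.  If f - f * f = u
   then f^ - f^ ^ 2 = u^, that is (1 - 2 f^) ^ 2 = 1 - 4 u^; at the origin this
   reads a - a ^ 2 = b for the integrals a, b of f, u, so b <= 1/4.  For such u the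
   series g of the statement converges in L^1 and also satisfies g^ - g^ ^ 2 = u^,
   because the squared Taylor polynomials of sqrt (1 - x) differ from 1 - x by
   polynomials with nonnegative coefficients whose value at 1 tends to 0.

   Hence (f^ - g^) (1 - f^ - g^) = 0.  Since u >= 0 and hyperplanes are null, u^ is
   never 1/4 away from the origin, so the two factors do not vanish together there;
   by continuity along a ray, either f^ = g^ on the whole open ray or f^ + g^ = 1
   on it.  The latter is impossible: averaging f^ + g^ along the ray gives 0.  By
   injectivity of the Fourier transform f = g almost everywhere. *)

(** * Taylor coefficients of the square root *)

(** At the origin the quadratic equation is symmetric under a -> 1 - a, so the bound a <= 1/2 is out
    of reach there and only follows from f = g. Positive dimension is essential: over a point, a = 1
    gives u = 0. The branch is therefore selected by the nonzero frequencies, where averaging along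
    a ray replaces the Riemann-Lebesgue lemma: f^ + g^ ought to tend to 0 at infinity and cannot
    stay equal to 1. Squaring the Taylor polynomials keeps complex square roots out of the proof:
    the identity for the squares is one between real polynomials and can be evaluated at any complex
    number of modulus at most 1. Injectivity of the Fourier transform is obtained without an
    inversion formula: the bounded functions that multiply the kernel of the transform into itself
    form an algebra closed under bounded pointwise limits, and this algebra contains the sines. *)

Lemma sqrt_coef1 (R : realType) : sqrt_coef R 1 = 1 / 2.
Proof. by rewrite /sqrt_coef /= expr1 mulr1. Qed.

Lemma sqrt_coefS (R : realType) n :
  sqrt_coef R n.+2 = sqrt_coef R n.+1 * ((2 * n.+1%:R - 1) / (2 * n.+2%:R)).
Proof.
rewrite /sqrt_coef.
have -> : (2 * n.+2%:Z - 3)%R = (2 * n + 1)%N by lia.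
(* For n = 0 the last factor is the convention (-1)!! = 1. *)
have E : (double_fact (2 * n + 1) = (2 * n + 1) * double_factz (2 * n.+1%:Z - 3))%N.
  case: n => [|n]; first by [].
  have -> : (2 * n.+2%:Z - 3)%R = (2 * n + 1)%N by lia.
  by have -> : (2 * n.+1 + 1 = (2 * n + 1).+2)%N by lia.
rewrite [double_factz _]/= E (factS n.+1) exprS.
have h1 : (n.+1)`!%:R != 0 :> R by rewrite pnatr_eq0 -lt0n fact_gt0.
have h2 : 2 ^+ n.+1 != 0 :> R by rewrite expf_neq0.
move: (n.+1`!) (2 ^+ n.+1) h1 h2 => a b h1 h2.
have h3 : n%:R + 2 != 0 :> R by rewrite -natrD pnatr_eq0; lia.
have h4 : 1 + n%:R != 0 :> R by rewrite nat1r pnatr_eq0.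
by rewrite !natrM natrD natrM; field; rewrite ?h1 ?h2 ?h4 1?addrC ?h3 ?h1 ?h2. 
Qed.

Lemma sqrt_coef_ge0 (R : realType) n : 0 <= sqrt_coef R n.
Proof. by rewrite /sqrt_coef divr_ge0// mulr_ge0// exprn_ge0. Qed.

Section sqrt_taylor.
Variable R : realType.

(** The constant term is separate because [sqrt_coef R 0] evaluates to the default 1, whose opposite
    would be the wrong coefficient. *)
Definition sqrt_taylor (n : nat) : R := if n is 0%N then 1 else - sqrt_coef R n.

Lemma sqrt_taylorS n :
  n.+1%:R * sqrt_taylor n.+1 = (n%:R - 1 / 2) * sqrt_taylor n.
Proof.
case: n => [|n] /=; first by rewrite sqrt_coef1; field.
rewrite sqrt_coefS.
have h3 : n%:R + 2 != 0 :> R by rewrite -natrD pnatr_eq0; lia.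
by field.
Qed.

Definition sqrt_sqr (n : nat) : R :=
  \sum_(i < n.+1) sqrt_taylor i * sqrt_taylor (n - i)%N.

(* The recurrence of the coefficients is [2 (1 - X) G' = - G], which gives
   [(1 - X) (G ^ 2)' = - G ^ 2]. *)
Lemma sqrt_sqrS n : n.+1%:R * sqrt_sqr n.+1 = (n%:R - 1) * sqrt_sqr n.
Proof.
(* Adding the sum to its reversal under i -> m - i makes the weights i and m - i add up to m. *)
have rev m : \sum_(i < m.+1) i%:R * (sqrt_taylor i * sqrt_taylor (m - i)%N) =
    m%:R / 2 * sqrt_sqr m.
  set S := LHS; have : S + S = m%:R * sqrt_sqr m.
    rewrite {1}/S (reindex_inj rev_ord_inj)/= /S -big_split/= mulr_sumr.
    apply: eq_bigr => i _; rewrite subSS.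
    have lim : (i <= m)%N by rewrite -ltnS.
    by rewrite subKn// natrB//; ring.
  by clearbody S => SS; rewrite -[LHS](mulfK (_ : 2 != 0))// mulr_natr mulr2n SS; field.
(* The term i = 0 vanishes; in the others the recurrence turns the weight i + 1 into i - 1/2 and
   lowers the index, so that [rev] applies once more, at n. *)
have := rev n.+1; rewrite big_ord_recl/= mul0r add0r.
under eq_bigr do rewrite /bump/= add1n subSS mulrA sqrt_taylorS mulrBl mulrBl.
rewrite sumrB.
under eq_bigr do rewrite -mulrA.
rewrite rev.
under [X in _ - X]eq_bigr do rewrite -mulrA.
rewrite -mulr_sumr -/(sqrt_sqr n) => E.
transitivity (2 * (n.+1%:R / 2 * sqrt_sqr n.+1)); first by field.
by rewrite -E; field.
Qed.

(** The first two values are 1 and -1; the factor n - 1 of the recurrence vanishes at n = 1 and so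
    kills every later coefficient. *)
Lemma sqrt_sqrE n : sqrt_sqr n = (1 - 'X)`_n.
Proof.
rewrite coefB coef1 coefX; case: n => [|n].
  by rewrite /sqrt_sqr big_ord1/= subr0 mulr1.
elim: n => [|n IH].
  have := sqrt_sqrS 0; rewrite {2}/sqrt_sqr big_ord1/= !mul1r mulr1 => ->.
  by ring.
have : n.+2%:R * sqrt_sqr n.+2 = 0.
  rewrite sqrt_sqrS IH; case: n {IH} => [|n]; first by rewrite subrr mul0r.
  by rewrite /= subr0 mulr0.
by move/eqP; rewrite mulf_eq0 pnatr_eq0 orFb => /eqP ->; rewrite subr0.
Qed.

Definition sqrt_poly (N : nat) : {poly R} := \poly_(k < N.+1) sqrt_taylor k.

(* All coefficients of [sqrt_rem N] are nonnegative, hence on the unit disk it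
   is bounded by its value at [1], which tends to [0]. *)
Definition sqrt_rem (N : nat) : {poly R} := sqrt_poly N ^+ 2 - (1 - 'X).

(** Up to degree N truncation does not affect the square, so the coefficient is 0. Beyond N, two
    indices that are at most N and add up to k are both positive, so each product has two factors of
    the form -c_i. *)
Lemma sqrt_rem_ge0 N k : 0 <= (sqrt_rem N)`_k.
Proof.
rewrite /sqrt_rem coefB expr2 coefM.
have [kN|Nk] := leqP k N.
  rewrite -sqrt_sqrE /sqrt_sqr -sumrB big1// => i _.
  have ik : (i <= k)%N by rewrite -ltnS.
  by rewrite !coef_poly !ifT ?subrr//; lia.
apply: addr_ge0; last first.
  by rewrite coefB coef1 coefX; case: k Nk => // k _; rewrite sub0r opprK ler0n.
apply: sumr_ge0 => -[i /= ik] _; rewrite !coef_poly.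
case: ifP => iN; last by rewrite mul0r.
case: ifP => kiN; last by rewrite mulr0.
case: i ik iN kiN => [|i] ik iN kiN; first by lia.
have -> : (k - i.+1 = (k - i.+2).+1)%N by lia.
by rewrite mulrNN mulr_ge0// sqrt_coef_ge0.
Qed.

Lemma horner_sqrt_poly N x :
  (sqrt_poly N).[x] = 1 - \sum_(1 <= n < N.+1) sqrt_coef R n * x ^+ n.
Proof.
rewrite horner_poly big_ord_recl/= expr0 mulr1; congr (_ + _).
rewrite big_add1/= big_mkord -sumrN; apply: eq_bigr => i _.
by rewrite /bump/= add1n mulNr.
Qed.

(** Telescoping: the recurrence gives 2 n c_n - 2 (n + 1) c_(n+1) = c_n. *)
Lemma horner_sqrt_poly1 N : (sqrt_poly N).[1] = 2 * (N.+1%:R * sqrt_coef R N.+1).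
Proof.
rewrite horner_sqrt_poly; elim: N => [|N IH].
  by rewrite big_geq// sqrt_coef1; field.
rewrite big_nat_recr//= opprD addrA IH expr1n sqrt_coefS.
have h3 : N%:R + 2 != 0 :> R by rewrite -natrD pnatr_eq0; lia.
by field.
Qed.

(** An elementary form of c_n = O(n^(-3/2)): the left-hand side decreases in N and equals 1/4 at N =
    0. *)
Lemma sqrt_coef_sqr_le N : N.+1%:R * (N.+1%:R * sqrt_coef R N.+1) ^+ 2 <= 1 / 4.
Proof.
elim: N => [|N IH]; first by rewrite sqrt_coef1 !mul1r; lra.
apply: le_trans IH; rewrite sqrt_coefS.
set c := sqrt_coef R _.
have h3 : N%:R + 2 != 0 :> R by rewrite -natrD pnatr_eq0; lia.
rewrite [leLHS](_ : _ = N.+2%:R * (2 * N.+1%:R - 1) ^+ 2 / 4 * c ^+ 2); last by field.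
rewrite [leRHS](_ : _ = N.+1%:R ^+ 3 * c ^+ 2); last by ring.
apply: ler_wpM2r; first exact: sqr_ge0.
have : 0 <= N%:R :> R by [].
by rewrite -[N.+2]addn2 -[N.+1]addn1 !natrD; nra.
Qed.

Lemma sqrt_rem1 N : (sqrt_rem N).[1] <= N.+1%:R^-1.
Proof.
rewrite !hornerE subrr subr0 horner_sqrt_poly1.
have := sqrt_coef_sqr_le N; set c := _ * sqrt_coef _ _ => h.
rewrite -[leRHS]mul1r ler_pdivlMr//.
lra.
Qed.

Lemma horner_sqrt_poly_ge0 N x : `|x| <= 1 -> 0 <= (sqrt_poly N).[x].
Proof.
move=> x1; apply: (@le_trans _ _ (sqrt_poly N).[1]).
  by rewrite horner_sqrt_poly1 mulr_ge0// mulr_ge0// sqrt_coef_ge0.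
rewrite !horner_sqrt_poly lerD2l lerN2 ler_sum// => i _.
apply: ler_wpM2l; first exact: sqrt_coef_ge0.
by rewrite expr1n (le_trans (ler_norm _))// normrX exprn_ile1.
Qed.

Lemma horner_sqrt_poly_le2 N x : `|x| <= 1 -> (sqrt_poly N).[x] <= 2.
Proof.
move=> x1; have : 0 <= (sqrt_poly N).[1] by rewrite horner_sqrt_poly_ge0// normr1.
rewrite !horner_sqrt_poly => P1.
suff : `|\sum_(1 <= n < N.+1) sqrt_coef R n * x ^+ n| <=
    \sum_(1 <= n < N.+1) sqrt_coef R n * 1 ^+ n.
  by rewrite ler_norml => /andP[? _]; lra.
rewrite (le_trans (ler_norm_sum _ _ _))// ler_sum// => i _.
rewrite normrM ger0_norm ?sqrt_coef_ge0// expr1n ler_wpM2l ?sqrt_coef_ge0//.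
by rewrite normrX exprn_ile1.
Qed.

(** The remainder bound makes the squares converge to 1 - x, endpoints included; as the polynomials
    are nonnegative on [-1, 1], they are the square roots of their squares and continuity of the
    root concludes. *)
Lemma sqrt_poly_cvg x : `|x| <= 1 ->
  (sqrt_poly N).[x] @[N --> \oo] --> Num.sqrt (1 - x).
Proof.
move=> x1.
have : (sqrt_poly N).[x] ^+ 2 @[N --> \oo] --> 1 - x.
  apply/cvgrPdist_le => e e0; near=> N.
  rewrite distrC; have -> : (sqrt_poly N).[x] ^+ 2 - (1 - x) = (sqrt_rem N).[x].
    by rewrite !hornerE.
  apply: (@le_trans _ _ (sqrt_rem N).[1]).
    rewrite !horner_coef (le_trans (ler_norm_sum _ _ _))// ler_sum// => i _.
    rewrite normrM ger0_norm ?sqrt_rem_ge0// expr1n ler_wpM2l ?sqrt_rem_ge0//.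
    by rewrite normrX exprn_ile1.
  apply: (le_trans (sqrt_rem1 N)).
  by apply: ltW; near: N; exact: (near_infty_natSinv_lt (PosNum e0)).
have -> : (fun N => (sqrt_poly N).[x]) =
    (fun N => Num.sqrt ((sqrt_poly N).[x] ^+ 2)).
  by apply/funext => N; rewrite sqrtr_sqr ger0_norm ?horner_sqrt_poly_ge0.
by move=> h; apply: continuous_cvg h; exact: sqrt_continuous.
Unshelve. all: by end_near. Qed.

Lemma sqrt_coef_derive1n n : (1 <= n)%N ->
  sqrt_coef R n = - (derive1n n (fun x : R => Num.sqrt (1 - x)) 0 / n`!%:R).
Proof.
(* The induction differentiates this formula, so it has to hold near the point and not only at 0;
   [sqrt_taylorS] absorbs the factor m - 1/2 that appears. *)
have D m x : x < 1 -> derive1n m (fun x : R => Num.sqrt (1 - x)) x =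
    m`!%:R * sqrt_taylor m * (1 - x) `^ (1 / 2 - m%:R).
  elim: m x => [|m IH] x x1.
    by rewrite /= !mul1r subr0 powR12_sqrt// subr_ge0 ltW.
  have x0 : 0 < 1 - x by rewrite subr_gt0.
  rewrite derive1nS derive1E (@near_eq_derive _ _ _ _
    (fun y : R => m`!%:R * sqrt_taylor m * (1 - y) `^ (1 / 2 - m%:R))); last first.
    near=> y; apply: IH; near: y; exact: lt_nbhsl.
  have dB : is_derive x 1 (fun y : R => 1 - y) (-1).
    have := is_deriveB (is_derive_cst (1 : R^o) (x : R^o) 1) (is_derive_id x 1).
    by rewrite sub0r.
  have dP := is_deriveZ (m`!%:R * sqrt_taylor m)
    (@is_derive1_comp _ (fun z => z `^ (1 / 2 - m%:R)) (fun y => 1 - y) x _ _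
      (is_derive1_powR (1 / 2 - m%:R) x0) dB).
  rewrite (@derive_val _ _ _ _ _ _ _ dP) /GRing.scale/= factS natrM.
  rewrite [RHS](_ : _ = m`!%:R * (m.+1%:R * sqrt_taylor m.+1) *
    (1 - x) `^ (1 / 2 - m.+1%:R)); last first.
    by rewrite -[sqrt_taylor m.+1]/(- sqrt_coef R m.+1); ring.
  rewrite sqrt_taylorS (_ : 1 / 2 - m.+1%:R = 1 / 2 - m%:R - 1); last by ring.
  by ring.
by case: n => // n _; rewrite D// subr0 powR1 mulr1 mulrAC divff ?mul1r ?opprK//.
Unshelve. all: by end_near. Qed.

Lemma sqrt_coef_equiv :
  exists2 K : R, 0 < K & sqrt_coef R ~_\oo (fun n => K * n%:R `^ (- (3 / 2))).
Proof.
(* With this choice [r n] is the square of (n+1)^(3/2) c_(n+1), so the constant K is the square root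
   of its limit. *)
pose e n : R := n.+1%:R * sqrt_coef R n.+1.
pose r n : R := n.+1%:R * e n ^+ 2.
have eS n : e n.+1 = e n * ((2 * n%:R + 1) / (2 * n.+1%:R)).
  rewrite /e sqrt_coefS.
  have n0 : 0 <= n%:R :> R by [].
  by field; apply/andP; split; apply: lt0r_neq0; lra.
have r_dec n : r n.+1 <= r n.
  rewrite /r eS; set c := e n.
  have h4 : n%:R + 1 != 0 :> R by rewrite natr1 pnatr_eq0.
  have n0 : 0 <= n%:R :> R by [].
  rewrite [leLHS](_ : _ =
    n.+2%:R * (2 * n%:R + 1) ^+ 2 / (4 * n.+1%:R ^+ 2) * c ^+ 2); last by field.
  apply: ler_wpM2r; first exact: sqr_ge0.
  rewrite ler_pdivrMr; last by rewrite mulr_gt0// exprn_gt0.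
  by rewrite -[n.+2]addn2 -[n.+1]addn1 !natrD; nra.
(* [r] decreases and [s] increases, so that the limit of [r] is positive. *)
pose s n : R := n.+1%:R * e n.+1 ^+ 2.
have s_inc n : s n <= s n.+1.
  rewrite /s (eS n.+1); set c := e n.+1.
  have h4 : n%:R + 2 != 0 :> R by rewrite -natrD pnatr_eq0; lia.
  have n0 : 0 <= n%:R :> R by [].
  rewrite [leRHS](_ : _ = (2 * n.+1%:R + 1) ^+ 2 / (4 * n.+2%:R) * c ^+ 2); last by field.
  apply: ler_wpM2r; first exact: sqr_ge0.
  rewrite ler_pdivlMr; last by rewrite mulr_gt0.
  by rewrite -[n.+2]addn2 -[n.+1]addn1 !natrD; nra.
(* The constant 1/16 is the value [s 0]. *)
have s_ge n : 1 / 16 <= s n.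
  elim: n => [|n IH]; last exact: le_trans (s_inc n).
  by rewrite /s eS /e sqrt_coef1; lra.
have r_ge n : 1 / 16 <= r n.
  apply: le_trans (r_dec n); apply: le_trans (s_ge n) _.
  by rewrite /r/s ler_wpM2r ?sqr_ge0// ler_nat.
have r_cvg : cvgn r.
  apply: nonincreasing_is_cvgn; first exact/nonincreasing_seqP.
  by exists (1 / 16) => _ [n _ <-].
have L_gt0 : 0 < limn r.
  apply: (@lt_le_trans _ _ (1 / 16)); first by lra.
  by apply: limr_ge => //; exact: nearW.
exists (Num.sqrt (limn r)); first by rewrite sqrtr_gt0.
apply/eqaddoP => eps eps0.
have : Num.sqrt (r n) @[n --> \oo] --> Num.sqrt (limn r).
  by apply: continuous_cvg => //; exact: sqrt_continuous.
move/cvgrPdist_le => /(_ (eps * Num.sqrt (limn r))).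
rewrite mulr_gt0// ?sqrtr_gt0// => /(_ isT) [N _ HN].
exists N.+1 => // -[//|n] /= Nn.
rewrite -[leLHS]/(`|sqrt_coef R n.+1 - Num.sqrt (limn r) * n.+1%:R `^ (- (3 / 2))|).
have -> : sqrt_coef R n.+1 = Num.sqrt (r n) * n.+1%:R `^ (- (3 / 2)).
  rewrite powRN (_ : 3 / 2 = 1 + 2^-1); last by field.
  rewrite powRD ?powRr1 ?powR12_sqrt//; last by apply/implyP => _; rewrite pnatr_eq0.
  rewrite /r sqrtrM// sqrtr_sqr ger0_norm ?mulr_ge0 ?sqrt_coef_ge0// /e.
  have : Num.sqrt n.+1%:R != 0 :> R by rewrite gt_eqF// sqrtr_gt0.
  by move: (Num.sqrt _) => q q0; field; rewrite q0 addrC natr1 pnatr_eq0.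
rewrite -mulrBl !normrM mulrA ler_wpM2r// distrC (le_trans (HN _ _))//.
by rewrite ger0_norm ?sqrtr_ge0.
Qed.

End sqrt_taylor.

(** * Lebesgue measure on tuples *)

Lemma measure_integral_indic (d : measure_display) (T : measurableType d)
    (R : realType) (mu : {measure set T -> \bar R}) (A : set T) :
  measurable A -> mu A = (\int[mu]_x (\1_A x)%:E)%E.
Proof. by move=> mA; rewrite integral_indic// setIT. Qed.

Section lebesgue_Rvec_theory.
Variable R : realType.
Local Notation leb := (@lebesgue_measure R).
Implicit Types d n : nat.

Lemma ge0_integral_lebesgue_RvecS n (F : Rvec R n.+1 -> \bar R) :
  measurable_fun setT F -> (forall t, 0 <= F t)%E ->
  (\int[lebesgue_Rvec R n.+1]_t F t =
   \int[leb]_x \int[lebesgue_Rvec R n]_t F (tcons (x, t)))%E.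
Proof.
move=> mF F0; rewrite [LHS](@ge0_integral_pushforward _ _ _ _ _ (@tcons _ _ n))//.
- rewrite preimage_setT fubini_tonelli1//.
  exact: (measurableT_comp mF (@measurable_tcons _ _ n)).
  by move=> x; exact: F0.
- exact: measurable_tcons.
Qed.

Lemma ge0_integral_lebesgue_RvecS_swap n (F : Rvec R n.+1 -> \bar R) :
  measurable_fun setT F -> (forall t, 0 <= F t)%E ->
  (\int[lebesgue_Rvec R n.+1]_t F t =
   \int[lebesgue_Rvec R n]_t \int[leb]_x F (tcons (x, t)))%E.
Proof.
move=> mF F0; rewrite ge0_integral_lebesgue_RvecS//.
rewrite (@fubini_tonelli _ _ _ _ _ leb (lebesgue_Rvec R n) (F \o @tcons _ _ n))//.
  exact: (measurableT_comp mF (@measurable_tcons _ _ n)).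
by move=> x; exact: F0.
Qed.

(** The translated measure gives half-open intervals their length, which characterizes Lebesgue
    measure. *)
Lemma lebesgue_measure_shift (a : R) (A : set (measurableTypeR R)) :
  measurable A -> leb ((fun x : R => x - a) @^-1` A) = leb A.
Proof.
move=> mA.
have ms : measurable_fun [set: measurableTypeR R]
    ((fun x => x - a) : measurableTypeR R -> measurableTypeR R).
  exact: measurable_funB.
rewrite -[LHS]/(pushforward leb
  ((fun x => x - a) : measurableTypeR R -> measurableTypeR R) A).
apply/esym.
apply: (@lebesgue_measure_unique _
  (measure_function_pushforward__canonical__measure_function_Measure leb ms))
  => // X [[b c] _ <-] /=.
rewrite /pushforward (_ : _ @^-1` _ = `]b + a, c + a]%classic).
  rewrite !lebesgue_measure_itv/= !lte_fin ltrD2r; case: ifPn => // _.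
  by rewrite -!EFinD; congr EFin; ring.
by apply/seteqP; split => x /=; rewrite !in_itv/= ltrBrDr lerBlDr.
Qed.

Lemma ge0_integral_lebesgue_shift (a : R) (F : R -> \bar R) :
  measurable_fun [set: measurableTypeR R] F -> (forall t, 0 <= F t)%E ->
  (\int[leb]_x F (x - a)%R = \int[leb]_x F x)%E.
Proof.
move=> mF F0.
have ms : measurable_fun [set: measurableTypeR R]
    ((fun x => x - a) : measurableTypeR R -> measurableTypeR R).
  exact: measurable_funB.
rewrite -[LHS](@ge0_integral_pushforward _ _ _ _ _ _ ms leb setT F)//.
apply: eq_measure_integral => A mA _.
exact: lebesgue_measure_shift.
Qed.

Lemma measurable_vsub d : measurable_fun setT (fun p : Rvec R d * Rvec R d => vsub p.1 p.2).
Proof.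
apply/measurable_fun_tnthP => i.
rewrite (_ : _ \o _ = (fun p => tnth p.1 i - tnth p.2 i)); last first.
  by apply/funext => p /=; rewrite tnth_mktuple.
apply: measurable_funB.
- exact: (measurableT_comp (measurable_tnth _) measurable_fst).
- exact: (measurableT_comp (measurable_tnth _) measurable_snd).
Qed.

Lemma measurable_vsubr d (y : Rvec R d) : measurable_fun setT (fun x => vsub x y).
Proof.
exact: (measurableT_comp (@measurable_vsub d) (measurable_pair2 y)).
Qed.

Lemma vsub_tcons d (x0 y0 : R) (x y : Rvec R d) :
  vsub (tcons (x0, x)) (tcons (y0, y)) = tcons (x0 - y0, vsub x y).
Proof.
apply: eq_from_tnth => i; rewrite tnth_mktuple.
by case: (unliftP ord0 i) => [j ->|->]//; rewrite !tnthS tnth_mktuple.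
Qed.

Lemma ge0_integral_lebesgue_Rvec_shift d (y : Rvec R d) (F : Rvec R d -> \bar R) :
  measurable_fun setT F -> (forall t, 0 <= F t)%E ->
  (\int[lebesgue_Rvec R d]_x F (vsub x y) = \int[lebesgue_Rvec R d]_x F x)%E.
Proof.
elim: d y F => [|d IH] y F mF F0.
  by apply: eq_integral => x _; congr F; apply: eq_from_tnth => -[].
have mFy : measurable_fun setT (fun x => F (vsub x y)).
  exact: (measurableT_comp mF (measurable_vsubr y)).
rewrite !ge0_integral_lebesgue_RvecS//.
case/tupleP: y mFy => y0 y mFy.
transitivity (\int[leb]_x \int[lebesgue_Rvec R d]_t F (tcons ((x - y0)%R, t)))%E.
  apply: eq_integral => x _.
  rewrite -[RHS](IH y (fun t => F (tcons ((x - y0)%R, t)))) => [| |t]; last exact: F0.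
    by apply: eq_integral => t _; rewrite -vsub_tcons.
  apply: (measurableT_comp mF).
  apply: (measurableT_comp (@measurable_tcons _ _ d)).
  exact: pair1_measurable.
apply: (ge0_integral_lebesgue_shift y0
  (F := (fun x => \int[lebesgue_Rvec R d]_t F (tcons (x, t)))%E)).
  apply: (@measurable_fun_fubini_tonelli_F _ _ _ _ _ (lebesgue_Rvec R d)
    (F \o @tcons _ _ d)) => [|x].
    exact: (measurableT_comp mF (@measurable_tcons _ _ d)).
  exact: F0.
by move=> x; apply: integral_ge0.
Qed.

Lemma lebesgue_Rvec_translate d (y : Rvec R d) (A : set (Rvec R d)) :
  measurable A ->
  pushforward (lebesgue_Rvec R d) (fun x => vsub x y) A = lebesgue_Rvec R d A.
Proof.
move=> mA; rewrite /pushforward.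
have mA' : measurable ((fun x : Rvec R d => vsub x y) @^-1` A).
  by rewrite -[X in measurable X]setTI; exact: measurable_vsubr.
rewrite !measure_integral_indic//.
rewrite -[RHS](ge0_integral_lebesgue_Rvec_shift y)//.
  by apply/measurable_EFinP; exact: measurable_indic.
Qed.

Lemma Rintegral_lebesgue_Rvec_shift d (y : Rvec R d) (f : Rvec R d -> R) :
  L1 f -> \int[lebesgue_Rvec R d]_x f (vsub x y) = \int[lebesgue_Rvec R d]_x f x.
Proof.
move=> intf.
have ms := measurable_vsubr y.
have mf := measurable_int _ intf.
rewrite /Rintegral; congr fine.
transitivity (\int[pushforward (lebesgue_Rvec R d) (fun x => vsub x y)]_x (f x)%:E)%E; last first.
  by apply: eq_measure_integral => A mA _; exact: lebesgue_Rvec_translate.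
rewrite [RHS](integral_pushforward ms)//.
rewrite preimage_setT.
apply/integrableP; split; first exact: (measurableT_comp mf ms).
rewrite (ge0_integral_lebesgue_Rvec_shift y (F := abse \o (EFin \o f))).
- by case/integrableP: intf.
- exact: (measurableT_comp (@abse_measurable _ _ ) mf).
- by move=> t /=.
Qed.

Definition dot d (k x : Rvec R d) : R := \sum_(i < d) (tnth k i * tnth x i : R).

Lemma measurable_dot d (k : Rvec R d) : measurable_fun [set: Rvec R d] (dot k).
Proof.
apply: measurable_sum => i; apply: measurable_funM; first exact: measurable_cst.
exact: measurable_tnth.
Qed.

Lemma dot_vsub d (k x y : Rvec R d) : dot k (vsub x y) = dot k x - dot k y.
Proof.
by rewrite /dot -sumrB; apply: eq_bigr => i _; rewrite tnth_mktuple mulrBr.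
Qed.

Lemma dot_tcons d (k0 x0 : R) (k x : Rvec R d) :
  dot (tcons (k0, k)) (tcons (x0, x)) = k0 * x0 + dot k x.
Proof.
by rewrite /dot big_ord_recl/=; congr (_ + _); apply: eq_bigr => i _; rewrite !tnthS.
Qed.

(** If the first entry of k is 0, fixing the first coordinate leaves a hyperplane of lower
    dimension. Otherwise fixing all the other coordinates leaves a single point, which calls for the
    opposite order in Tonelli. *)
Lemma lebesgue_Rvec_hyperplane d (k : Rvec R d) (c : R) :
  (exists i, tnth k i != 0 :> R) ->
  lebesgue_Rvec R d [set x | dot k x = c] = 0%E.
Proof.
elim: d k c => [|d IH] k c; first by move=> [[]].
have mH n (l : Rvec R n) b : measurable [set x | dot l x = b].
  rewrite (_ : mkset _ = dot l @^-1` [set b])// -[X in measurable X]setTI.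
  exact: measurable_dot.
case/tupleP: k => k0 k kn0.
rewrite measure_integral_indic; last exact: mH.
set A := [set x | _].
have mA : measurable A by exact: mH.
have mI : measurable_fun [set: Rvec R d.+1] (EFin \o \1_A : _ -> \bar R).
  by apply/measurable_EFinP; exact: measurable_indic.
have E x t : \1_A (tcons (x, t)) = (k0 * x + dot k t == c)%:R :> R.
  rewrite indicE; congr ((nat_of_bool _)%:R); rewrite -(dot_tcons k0 x k t).
  by apply/idP/eqP; rewrite inE.
have [k00|k00] := eqVneq (k0 : R) 0.
  rewrite ge0_integral_lebesgue_RvecS//.
  apply: integral0_eq => x _.
  rewrite -[RHS](IH k (c - k0 * x)).
    rewrite [RHS]measure_integral_indic; last exact: mH.
    apply: eq_integral => t _.
    rewrite E indicE; congr (((nat_of_bool _)%:R)%:E).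
    by apply/eqP/idP; rewrite inE/=; [move=> <-|move=> ->]; ring.
  case: kn0 => i; case: (unliftP ord0 i) => [j ->|->]; last by rewrite k00 eqxx.
  by rewrite tnthS; exists j.
rewrite ge0_integral_lebesgue_RvecS_swap//.
apply: integral0_eq => t _.
rewrite -[RHS](lebesgue_measure_set1 ((c - dot k t) / k0)).
rewrite [RHS]measure_integral_indic; last exact: measurable_set1.
apply: eq_integral => x _.
rewrite E indicE; congr (((nat_of_bool _)%:R)%:E).
by apply/eqP/idP; rewrite inE/=; [move=> <-|move=> ->]; field.
Qed.

End lebesgue_Rvec_theory.

(** * Real-valued integrals *)

Section Rintegral_ae.
Context (dT : measure_display) (T : measurableType dT) (R : realType).
Variable mu : {measure set T -> \bar R}.
Implicit Types f g h : T -> R.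
Local Notation intg f := (mu.-integrable setT (EFin \o f)).

Lemma integrable_measurable f : intg f -> measurable_fun setT f.
Proof. by move=> /measurable_int/measurable_EFinP. Qed.

Lemma integrable_bound f g : measurable_fun setT f -> intg g ->
  (forall x, `|f x| <= `|g x|) -> intg f.
Proof.
move=> mf ig fg; apply: (le_integrable _ _ _ ig) => //.
  exact/measurable_EFinP.
by move=> x _ /=; rewrite lee_fin.
Qed.

Lemma integrable_scale a f : intg f -> intg (fun x => a * f x).
Proof. exact: (@integrableZl _ _ _ mu setT measurableT a (EFin \o f)). Qed.

Lemma integrableM_bound f h M : intg f -> measurable_fun setT h ->
  (forall x, `|h x| <= M) -> intg (fun x => f x * h x).
Proof.
move=> intf mh hM; apply: (@integrable_bound _ (fun x => M * f x)).
- by apply: measurable_funM => //; exact: integrable_measurable.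
- exact: integrable_scale.
- by move=> x; rewrite !normrM mulrC ler_wpM2r// (le_trans (hM x))// ler_norm.
Qed.

Lemma integrable_lin a b f g :
  intg f -> intg g -> intg (fun x => a * f x + b * g x).
Proof.
move=> intf intg_; exact: (@integrableD _ _ _ mu setT measurableT
  (EFin \o (fun x => a * f x)) (EFin \o (fun x => b * g x))
  (integrable_scale a intf) (integrable_scale b intg_)).
Qed.

Lemma Rintegral_lin a b f g : intg f -> intg g ->
  \int[mu]_x (a * f x + b * g x) = a * \int[mu]_x f x + b * \int[mu]_x g x.
Proof.
move=> intf intg_; rewrite RintegralD ?RintegralZl//; exact: integrable_scale.
Qed.

Lemma ae_eq_Rintegral f g : measurable_fun setT f -> measurable_fun setT g ->
  {ae mu, forall x, f x = g x} -> \int[mu]_x f x = \int[mu]_x g x.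
Proof.
move=> mf mg fg; rewrite /Rintegral; congr fine; apply: ae_eq_integral => //.
- exact/measurable_EFinP.
- exact/measurable_EFinP.
- by apply: filterS fg => x /= -> _.
Qed.

Lemma ae_Rintegral_ge0 f : measurable_fun setT f ->
  {ae mu, forall x, 0 <= f x} -> 0 <= \int[mu]_x f x.
Proof.
move=> mf f0; rewrite (@ae_eq_Rintegral f (Num.norm \o f))//.
- by apply: Rintegral_ge0 => x _ /=.
- exact: measurableT_comp.
- by apply: filterS f0 => x /= f0; rewrite ger0_norm.
Qed.

Lemma ae_le_Rintegral f g : intg f -> intg g ->
  {ae mu, forall x, f x <= g x} -> \int[mu]_x f x <= \int[mu]_x g x.
Proof.
move=> intf intg_ fg; rewrite -subr_ge0.
have <- : \int[mu]_x (-1 * f x + 1 * g x) = \int[mu]_x g x - \int[mu]_x f x.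
  by rewrite Rintegral_lin// mulN1r mul1r addrC.
apply: ae_Rintegral_ge0; first exact/integrable_measurable/integrable_lin.
by apply: filterS fg => x fg; rewrite mulN1r mul1r addrC subr_ge0.
Qed.

Lemma Rintegral_eq0_ae f : intg f -> {ae mu, forall x, 0 <= f x} ->
  \int[mu]_x f x = 0 -> {ae mu, forall x, f x = 0}.
Proof.
move=> intf f0 If; have mf := integrable_measurable intf.
have : (\int[mu]_x `|(EFin \o f) x| = 0)%E.
  rewrite -[LHS]fineK; last exact/integrable_fin_num/integrable_abse.
  transitivity ((\int[mu]_x f x)%:E); last by rewrite If.
  congr EFin.
  apply: (@ae_eq_Rintegral (Num.norm \o f)) => //.
    exact: measurableT_comp.
  by apply: filterS f0 => x /= f0; rewrite ger0_norm.
move/(ae_eq_integral_abs mu measurableT (measurable_int _ intf)).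
by apply: filterS => x /(_ I) [].
Qed.

Lemma Rintegral_dominated (f_ : nat -> T -> R) f g :
  (forall n, measurable_fun setT (f_ n)) -> measurable_fun setT f ->
  {ae mu, forall x, f_ n x @[n --> \oo] --> f x} ->
  intg g -> {ae mu, forall x n, `|f_ n x| <= g x} ->
  [/\ intg f, (\int[mu]_x `|(f_ n x - f x)%:E|)%E @[n --> \oo] --> 0%E
    & \int[mu]_x f_ n x @[n --> \oo] --> \int[mu]_x f x].
Proof.
move=> mf_ mf f_f ig f_g.
have [| | | | |intf c0 c1] := @dominated_convergence _ _ _ mu setT measurableT
  (fun n => EFin \o f_ n) (EFin \o f) (EFin \o g).
- by move=> n; exact/measurable_EFinP.
- exact/measurable_EFinP.
- by apply: filterS f_f => x h _; apply: cvg_comp h _; exact: cvg_id.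
- exact: ig.
- by apply: filterS f_g => x h n _ /=; rewrite lee_fin.
split => //.
apply: fine_cvg; rewrite fineK//.
exact: integrable_fin_num.
Qed.

End Rintegral_ae.

Section Rintegral_fubini.
Context (d1 d2 : measure_display) (T1 : measurableType d1) (T2 : measurableType d2).
Variable R : realType.
Variable m1 : {sigma_finite_measure set T1 -> \bar R}.
Variable m2 : {sigma_finite_measure set T2 -> \bar R}.
Variable W : T1 * T2 -> R.
Hypothesis intW : (m1 \x m2)%E.-integrable setT (EFin \o W).

Let F x := (\int[m2]_y (W (x, y))%:E)%E.
Let iF : m1.-integrable setT F := integrable_fubini_F intW.
Let mF : measurable_fun setT F := measurable_int _ iF.
Let G y := (\int[m1]_x (W (x, y))%:E)%E.
Let mG : measurable_fun setT G := measurable_fubini_G intW.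

Lemma measurable_Rintegral1 : measurable_fun setT (fun x => \int[m2]_y W (x, y)).
Proof. exact: (measurableT_comp (fine_measurable measurableT) mF). Qed.

Lemma measurable_Rintegral2 : measurable_fun setT (fun y => \int[m1]_x W (x, y)).
Proof. exact: (measurableT_comp (fine_measurable measurableT) mG). Qed.

Lemma integrable_Rintegral1 :
  m1.-integrable setT (EFin \o (fun x => \int[m2]_y W (x, y))).
Proof.
apply: (le_integrable measurableT _ _ iF).
  apply/measurable_EFinP; exact: measurable_Rintegral1.
move=> x _ /=; rewrite -/(F x) /Rintegral -/(F x).
by case: (F x) => //= ; rewrite normr0 leey.
Qed.

(** [Rintegral] sends an infinite inner integral to 0, but almost every section of W is integrable,
    so the outer integrals do not notice. *)
Lemma Rintegral_fubini :
  \int[m1]_x \int[m2]_y W (x, y) = \int[m2]_y \int[m1]_x W (x, y).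
Proof.
rewrite /Rintegral; congr fine.
transitivity (\int[m1]_x F x)%E.
  apply: ae_eq_integral => //.
    apply/measurable_EFinP; exact: measurable_Rintegral1.
  apply: filterS (ae_integrable1 intW) => x ix _.
  by rewrite fineK//; exact: integrable_fin_num.
rewrite (Fubini intW); apply: ae_eq_integral => //.
  apply/measurable_EFinP; exact: measurable_Rintegral2.
apply: filterS (ae_integrable2 intW) => x ix _.
by rewrite fineK//; exact: integrable_fin_num.
Qed.

End Rintegral_fubini.

(** * Convolution and Fourier transform *)

Section convolution_fourier.
Local Open Scope complex_scope.
Variables (R : realType) (d : nat).
Local Notation mu := (lebesgue_Rvec R d).
Implicit Types (f g u w : Rvec R d -> R) (k x y : Rvec R d).

Lemma L1_shift f y : L1 f -> L1 (fun x => f (vsub x y)).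
Proof.
move=> intf; have mf := measurable_int _ intf.
apply/integrableP; split; first exact: (measurableT_comp mf (measurable_vsubr y)).
rewrite (ge0_integral_lebesgue_Rvec_shift y (F := abse \o (EFin \o f))).
- by case/integrableP: intf.
- exact: (measurableT_comp (@abse_measurable _ _ ) mf).
- by move=> t /=.
Qed.

(** By Tonelli with x innermost: translation invariance turns the inner integral into the norm of f
    times |g y|, and the total is the product of the two norms. *)
Lemma integrable_convolution_kernel f g : L1 f -> L1 g ->
  (mu \x mu)%E.-integrable setT
    (EFin \o (fun p : Rvec R d * Rvec R d => f (vsub p.1 p.2) * g p.2)).
Proof.
move=> intf intg.
have mf := integrable_measurable intf; have mg := integrable_measurable intg.
have mK : measurable_fun setT
    (EFin \o (fun p : Rvec R d * Rvec R d => f (vsub p.1 p.2) * g p.2)).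
  apply/measurable_EFinP; apply: measurable_funM.
    exact: (measurableT_comp mf (@measurable_vsub R d)).
  exact: (measurableT_comp mg measurable_snd).
apply/(integrable21ltyP mu mu mK) => /=.
have nf : (\int[mu]_x `|(f x)%:E| < +oo)%E by case/integrableP: intf.
have ng : (\int[mu]_x `|(g x)%:E| < +oo)%E by case/integrableP: intg.
have mnf : measurable_fun setT (fun x => `|(f x)%:E|%E).
  by apply: (measurableT_comp (@abse_measurable _ _)); exact/measurable_EFinP.
have mng : measurable_fun setT (fun x => `|(g x)%:E|%E).
  by apply: (measurableT_comp (@abse_measurable _ _)); exact/measurable_EFinP.
have -> : (\int[mu]_y \int[mu]_x `|(f (vsub x y) * g y)%:E| =
    \int[mu]_y (\int[mu]_x `|(f x)%:E| * `|(g y)%:E|))%E.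
  apply: eq_integral => y _.
  transitivity (\int[mu]_x (`|(f (vsub x y))%:E| * `|(g y)%:E|))%E.
    by apply: eq_integral => x _; rewrite EFinM abseM.
  rewrite ge0_integralZr//; last exact: (measurableT_comp mnf (measurable_vsubr y)).
  by rewrite (ge0_integral_lebesgue_Rvec_shift y (F := fun x => `|(f x)%:E|%E)).
rewrite ge0_integralZl//; last exact: integral_ge0.
rewrite lte_mul_pinfty//; first exact: integral_ge0.
by rewrite ge0_fin_numE//; exact: integral_ge0.
Qed.

Lemma L1_convolution f g : L1 f -> L1 g -> L1 (convolution f g).
Proof.
move=> intf intg.
exact: integrable_Rintegral1 (integrable_convolution_kernel intf intg).
Qed.

(** Convolution tested against a bounded weight: cosines and sines give the Fourier transform of a
    convolution, indicators give its positivity. *)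
Lemma Rintegral_convolution f g (phi : Rvec R d -> R) : L1 f -> L1 g ->
  measurable_fun setT phi -> (forall x, `|phi x| <= 1) ->
  \int[mu]_x (convolution f g x * phi x) =
  \int[mu]_y ((\int[mu]_x (f (vsub x y) * phi x)) * g y).
Proof.
move=> intf intg mphi phi1.
have iK := integrable_convolution_kernel intf intg.
pose W (p : Rvec R d * Rvec R d) := f (vsub p.1 p.2) * g p.2 * phi p.1.
have iW : (mu \x mu)%E.-integrable setT (EFin \o W).
  apply: (integrableM_bound iK) => [|p]; last exact: phi1.
  exact: (measurableT_comp mphi measurable_fst).
transitivity (\int[mu]_x \int[mu]_y W (x, y)).
  apply: ae_eq_Rintegral.
  - apply: measurable_funM => //.
    exact: integrable_measurable (L1_convolution intf intg).
  - exact: measurable_Rintegral1 iW.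
  - apply: filterS (ae_integrable1 iK) => x ix.
    by rewrite /W/= RintegralZr.
rewrite (Rintegral_fubini iW); apply: eq_Rintegral => y _.
rewrite -RintegralZr//; first by apply: eq_Rintegral => x _; rewrite /W/= mulrAC.
exact: integrableM_bound (L1_shift y intf) mphi phi1.
Qed.

Definition fourier_cos f k : R := \int[mu]_x (f x * cos (dot k x)).
Definition fourier_sin f k : R := \int[mu]_x (f x * sin (dot k x)).

Lemma measurable_cos_dot k : measurable_fun setT (fun x => cos (dot k x)).
Proof.
exact: (measurableT_comp (continuous_measurable_fun (@continuous_cos R))
  (measurable_dot k)).
Qed.

Lemma measurable_sin_dot k : measurable_fun setT (fun x => sin (dot k x)).
Proof.
exact: (measurableT_comp (continuous_measurable_fun (@continuous_sin R))
  (measurable_dot k)).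
Qed.

Lemma L1_cos f k : L1 f -> L1 (fun x => f x * cos (dot k x)).
Proof.
move=> intf; apply: integrableM_bound => //; first exact: measurable_cos_dot.
by move=> x; exact: cos_max.
Qed.

Lemma L1_sin f k : L1 f -> L1 (fun x => f x * sin (dot k x)).
Proof.
move=> intf; apply: integrableM_bound => //; first exact: measurable_sin_dot.
by move=> x; exact: sin_max.
Qed.

(** Together with the sine version, this is the factor e^(i k.y) that a translation by y produces in
    the transform. *)
Lemma fourier_cos_shift f k y : L1 f ->
  \int[mu]_x (f (vsub x y) * cos (dot k x)) =
  cos (dot k y) * fourier_cos f k - sin (dot k y) * fourier_sin f k.
Proof.
move=> intf.
have ic := L1_cos k intf; have is_ := L1_sin k intf.
transitivity (\int[mu]_x (cos (dot k y) * (f x * cos (dot k x)) +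
   (- sin (dot k y)) * (f x * sin (dot k x)))).
  rewrite -[RHS](Rintegral_lebesgue_Rvec_shift y).
    apply: eq_Rintegral => x _.
    rewrite -{1}[dot k x](subrK (dot k y)) -dot_vsub cosD; ring.
  exact: integrable_lin.
by rewrite Rintegral_lin// mulNr.
Qed.

Lemma fourier_sin_shift f k y : L1 f ->
  \int[mu]_x (f (vsub x y) * sin (dot k x)) =
  cos (dot k y) * fourier_sin f k + sin (dot k y) * fourier_cos f k.
Proof.
move=> intf.
have ic := L1_cos k intf; have is_ := L1_sin k intf.
transitivity (\int[mu]_x (cos (dot k y) * (f x * sin (dot k x)) +
   sin (dot k y) * (f x * cos (dot k x)))).
  rewrite -[RHS](Rintegral_lebesgue_Rvec_shift y).
    apply: eq_Rintegral => x _.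
    rewrite -{1}[dot k x](subrK (dot k y)) -dot_vsub sinD; ring.
  exact: integrable_lin.
by rewrite Rintegral_lin.
Qed.

(** The integral of f(x) e^(i k.x), assembled from two real integrals so that all integration stays
    real-valued. *)
Definition fourier f k : R[i] := fourier_cos f k +i* fourier_sin f k.

Lemma fourier_convolution f g k : L1 f -> L1 g ->
  fourier (convolution f g) k = fourier f k * fourier g k.
Proof.
move=> intf intg.
have ic := L1_cos k intg; have is_ := L1_sin k intg.
apply/eqP; rewrite eq_complex /=; apply/andP; split; apply/eqP.
  rewrite {1}/fourier_cos Rintegral_convolution//; last 2 first.
  - exact: measurable_cos_dot.
  - by move=> x; exact: cos_max.
  rewrite -mulNr -Rintegral_lin//; apply: eq_Rintegral => y _.
  by rewrite fourier_cos_shift//; ring.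
rewrite {1}/fourier_sin Rintegral_convolution//; last 2 first.
- exact: measurable_sin_dot.
- by move=> x; exact: sin_max.
rewrite -Rintegral_lin//; apply: eq_Rintegral => y _.
by rewrite fourier_sin_shift//; ring.
Qed.

Lemma fourier_lin a b f g k : L1 f -> L1 g ->
  fourier (fun x => a * f x + b * g x) k = a%:C * fourier f k + b%:C * fourier g k.
Proof.
move=> intf intg.
apply/eqP; rewrite eq_complex /=; apply/andP; split; apply/eqP; rewrite !mul0r !(subr0, addr0).
  rewrite -Rintegral_lin; [|exact: L1_cos..].
  by apply: eq_Rintegral => x _; ring.
rewrite -Rintegral_lin; [|exact: L1_sin..].
by apply: eq_Rintegral => x _; ring.
Qed.

End convolution_fourier.

(** * Injectivity of the Fourier transform *)

Section fourier_injective.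
Local Open Scope complex_scope.
Variables (R : realType) (d : nat).
Local Notation mu := (lebesgue_Rvec R d).
Implicit Types (f g u w h : Rvec R d -> R) (k x y : Rvec R d).

Definition fourier_null w := L1 w /\ forall k, fourier w k = 0.

Lemma fourier_nullP w : fourier_null w <->
  [/\ L1 w, forall k, fourier_cos w k = 0 & forall k, fourier_sin w k = 0].
Proof.
split=> [[iw w0]|[iw c0 s0]]; last by split=> // k; rewrite /fourier c0 s0.
by split=> // k; have /eqP := w0 k; rewrite eq_complex/= => /andP[/eqP ? /eqP ?].
Qed.

Lemma fourier_null_lin a b f g : fourier_null f -> fourier_null g ->
  fourier_null (fun x => a * f x + b * g x).
Proof.
move=> [intf f0] [intg g0]; split; first exact: integrable_lin.
by move=> k; rewrite fourier_lin// f0 g0 !mulr0 addr0.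
Qed.

(* The indicators of measurable sets are multipliers, which gives the injectivity
   of the Fourier transform: a function with zero transform has zero integral on
   every measurable set. *)
Definition fourier_multiplier h :=
  [/\ measurable_fun setT h, exists M, forall x, `|h x| <= M &
    forall w, fourier_null w -> fourier_null (fun x => w x * h x)].

Lemma fourier_multiplierM g h : fourier_multiplier g -> fourier_multiplier h ->
  fourier_multiplier (fun x => g x * h x).
Proof.
move=> [mg [M gM] gP] [mh [N hN] hP]; split.
- exact: measurable_funM.
- by exists (M * N) => x; rewrite normrM ler_pM.
- by move=> w /gP/hP; under eq_fun do rewrite -mulrA.
Qed.

Lemma fourier_multiplier_lin a b g h : fourier_multiplier g ->
  fourier_multiplier h -> fourier_multiplier (fun x => a * g x + b * h x).
Proof.
move=> [mg [M gM] gP] [mh [N hN] hP]; split.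
- by apply: measurable_funD; apply: measurable_funM.
- exists (`|a| * M + `|b| * N) => x.
  by rewrite (le_trans (ler_normD _ _))// !normrM lerD// ler_wpM2l.
- move=> w w0; have := fourier_null_lin a b (gP w w0) (hP w w0).
  by under eq_fun do rewrite mulrCA [b * _]mulrCA -mulrDr.
Qed.

Lemma fourier_multiplier1 : fourier_multiplier (fun=> 1).
Proof.
split; [exact: measurable_cst|by exists 1 => x; rewrite normr1|].
by move=> w; under eq_fun do rewrite mulr1.
Qed.

Lemma fourier_multiplier_cst a : fourier_multiplier (fun=> a).
Proof.
have := fourier_multiplier_lin a 0 fourier_multiplier1 fourier_multiplier1.
by under eq_fun do rewrite mulr1 mul0r addr0.
Qed.

Lemma fourier_multiplier_horner (p : {poly R}) h : fourier_multiplier h ->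
  fourier_multiplier (fun x => p.[h x]).
Proof.
move=> hP; elim/poly_ind: p => [|p c IH].
  by under eq_fun do rewrite horner0; exact: fourier_multiplier_cst.
under eq_fun do rewrite hornerMXaddC.
have := fourier_multiplier_lin 1 1 (fourier_multiplierM IH hP) (fourier_multiplier_cst c).
by under eq_fun do rewrite !mul1r.
Qed.

(** Dominated convergence, with M |w| as the bound. This closure property is what leads from
    trigonometric polynomials to indicators. *)
Lemma fourier_multiplier_cvg (h_ : nat -> Rvec R d -> R) h (M : R) :
  (forall n, fourier_multiplier (h_ n)) -> (forall n x, `|h_ n x| <= M) ->
  (forall x, h_ n x @[n --> \oo] --> h x) -> fourier_multiplier h.
Proof.
move=> hP hM h_h.
have mh : measurable_fun setT h.
  apply: (measurable_fun_cvg (h := h_)) => [n|x _]; first by case: (hP n).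
  exact: h_h.
have hM' x : `|h x| <= M.
  have hx : `|h_ n x| @[n --> \oo] --> `|h x| by apply: cvg_norm; exact: h_h.
  rewrite -(cvg_lim _ hx)//.
  by apply: limr_le; [apply/cvg_ex; eexists; exact: hx|exact: nearW].
split=> //; first by exists M.
move=> w w0; have [iw wc ws] := (fourier_nullP w).1 w0.
have lim0 (phi : Rvec R d -> R) : measurable_fun setT phi -> (forall x, `|phi x| <= 1) ->
    (forall n, \int[mu]_x (w x * h_ n x * phi x) = 0) ->
    \int[mu]_x (w x * h x * phi x) = 0.
  move=> mphi phi1 I0.
  have mw := integrable_measurable iw.
  have [] := @Rintegral_dominated _ _ _ mu (fun n x => w x * h_ n x * phi x)
    (fun x => w x * h x * phi x) (fun x => `|w x| * M).
  - by move=> n; apply: measurable_funM => //; apply: measurable_funM => //; case: (hP n).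
  - by apply: measurable_funM => //; apply: measurable_funM.
  - by apply: aeW => x; apply: cvgMl; apply: cvgMr; exact: h_h.
  - apply: integrableM_bound; last by move=> x; exact: lexx.
      exact: integrable_norm.
    exact: measurable_cst.
  - apply: aeW => x n; rewrite !normrM -[leRHS]mulr1 ler_pM// ?mulr_ge0//.
    by rewrite ler_wpM2l.
  move=> _ _; rewrite [X in X @ _ --> _](_ : _ = fun=> 0); last exact/funext.
  by move=> /(cvg_unique _ (@cvg_cst _ _ _ _ _)) => /(_ _) <-.
apply/fourier_nullP; split.
- exact: integrableM_bound hM'.
- move=> k; apply: lim0; [exact: measurable_cos_dot|by move=> x; exact: cos_max|].
  move=> n; have [_ _ /(_ w w0)] := hP n.
  by move=> /fourier_nullP[_ /(_ k)].
- move=> k; apply: lim0; [exact: measurable_sin_dot|by move=> x; exact: sin_max|].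
  move=> n; have [_ _ /(_ w w0)] := hP n.
  by move=> /fourier_nullP[_ _ /(_ k)].
Qed.

Lemma dotC k x : dot k x = dot x k.
Proof. by apply: eq_bigr => i _; rewrite mulrC. Qed.

(** Multiplying by the sine shifts frequencies by k and -k: by the product formulas, the transform
    at l is a combination of transforms of w at l + k and l - k, all zero. *)
Lemma fourier_multiplier_sin k (b : R) : fourier_multiplier (fun x => sin (dot k x - b)).
Proof.
have ms : measurable_fun setT (fun x => sin (dot k x - b)).
  apply: (measurableT_comp (continuous_measurable_fun (@continuous_sin R))).
  by apply: measurable_funB => //; exact: measurable_dot.
have s1 x : `|sin (dot k x - b)| <= 1 by exact: sin_max.
split=> //; first by exists 1.
move=> w /fourier_nullP[iw wc ws].
(* The vector m is l + k, written as l - (0 - k). *)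
have vadd l : exists2 m : Rvec R d, (forall x, dot m x = dot l x + dot k x)
    & forall x, dot (vsub l k) x = dot l x - dot k x.
  exists (vsub l (vsub [tuple 0 | _ < d] k)) => x; last by rewrite !(dotC _ x) dot_vsub.
  rewrite !(dotC _ x) !dot_vsub [dot x [tuple 0 | _ < d]]big1 ?sub0r ?opprK//.
  by move=> i _; rewrite tnth_mktuple mulr0.
have I0 (f1 f2 : Rvec R d -> R) a1 a2 : L1 f1 -> L1 f2 ->
    \int[mu]_x f1 x = 0 -> \int[mu]_x f2 x = 0 ->
    L1 (fun x => a1 * f1 x + a2 * f2 x) /\ \int[mu]_x (a1 * f1 x + a2 * f2 x) = 0.
  move=> i1 i2 f10 f20; split; first exact: integrable_lin.
  by rewrite Rintegral_lin// f10 f20 !mulr0 addr0.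
apply/fourier_nullP; split; first exact: integrableM_bound s1.
- move=> l; have [m mE sE] := vadd l.
  have [i1 e1] := I0 _ _ (cos b / 2) (- (cos b / 2)) (L1_sin m iw)
    (L1_sin (vsub l k) iw) (ws _) (ws _).
  have [i2 e2] := I0 _ _ (- (sin b / 2)) (- (sin b / 2)) (L1_cos m iw)
    (L1_cos (vsub l k) iw) (wc _) (wc _).
  have [_ <-] := I0 _ _ 1 1 i1 i2 e1 e2.
  by apply: eq_Rintegral => x _; rewrite mE sE !(sinB, cosB, sinD, cosD); field.
- move=> l; have [m mE sE] := vadd l.
  have [i1 e1] := I0 _ _ (cos b / 2) (- (cos b / 2)) (L1_cos (vsub l k) iw)
    (L1_cos m iw) (wc _) (wc _).
  have [i2 e2] := I0 _ _ (- (sin b / 2)) (- (sin b / 2)) (L1_sin m iw)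
    (L1_sin (vsub l k) iw) (ws _) (ws _).
  have [_ <-] := I0 _ _ 1 1 i1 i2 e1 e2.
  by apply: eq_Rintegral => x _; rewrite mE sE !(sinB, cosB, sinD, cosD); field.
Qed.

(* [sqrt_poly R N] evaluated at [1 - s ^ 2] tends to [|s|], and then
   [1 - (1 - s^+) ^ n] tends to the indicator of [0 < s]. *)
Lemma fourier_multiplier_gt0 h : fourier_multiplier h ->
  (forall x, `|h x| <= 1) -> fourier_multiplier (fun x => (0 < h x)%R%:R).
Proof.
move=> hP h1.
have h2 x : `|1 - h x ^+ 2| <= 1.
  have := h1 x; rewrite ler_norml => /andP[? ?].
  by rewrite ger0_norm; nra.
have absP : fourier_multiplier (fun x => `|h x|).
  apply: (@fourier_multiplier_cvg
    (fun N x => (sqrt_poly R N \Po (1 - 'X ^+ 2)).[h x]) _ 2).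
  - by move=> N; exact: fourier_multiplier_horner.
  - move=> N x; rewrite horner_comp !hornerE.
    by rewrite ger0_norm ?horner_sqrt_poly_ge0// horner_sqrt_poly_le2.
  - move=> x; under eq_fun do rewrite horner_comp !hornerE.
    have := sqrt_poly_cvg (h2 x).
    by rewrite opprB addrCA subrr addr0 sqrtr_sqr.
pose p x := (h x + `|h x|) / 2.
have p01 x : 0 <= p x <= 1.
  have := h1 x; have := ler_norm (h x); have := normr_ge0 (h x).
  have := ler_norm (- h x); rewrite normrN /p => ? ? ? ?.
  by apply/andP; split; lra.
have pP : fourier_multiplier p.
  have := fourier_multiplier_lin (1 / 2) (1 / 2) hP absP.
  by rewrite (_ : (fun x => _) = p)//; apply/funext => x; rewrite /p; field.
apply: (@fourier_multiplier_cvg (fun n x => (1 - (1 - 'X) ^+ n).[p x]) _ 1).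
- by move=> n; exact: fourier_multiplier_horner.
- move=> n x; rewrite !hornerE.
  have /andP[p0 p1] := p01 x.
  have q0 : 0 <= (1 - p x) ^+ n by rewrite exprn_ge0// subr_ge0.
  have q1 : (1 - p x) ^+ n <= 1 by rewrite exprn_ile1 ?subr_ge0// gerBl.
  by rewrite ger0_norm; lra.
- move=> x; under eq_fun do rewrite !hornerE.
  have /andP[p0 p1] := p01 x.
  case: ltP => hx.
    rewrite (_ : true%:R = 1 - 0 :> R); last by rewrite subr0.
    apply: cvgB; first exact: cvg_cst.
    by apply: cvg_expr; rewrite ger0_norm ?subr_ge0// gtrBl /p gtr0_norm//; lra.
  rewrite /p ler0_norm// addrN mul0r subr0.
  under eq_fun do rewrite expr1n subrr.
  exact: cvg_cst.
Qed.

(* The indicator of [a < x_i] is the limit of those of [0 < sin ((x_i - a) / m)]. *)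
Lemma fourier_multiplier_coord_gt (i : 'I_d) (a : R) :
  fourier_multiplier (fun x => (a < tnth x i)%R%:R).
Proof.
pose e (m : nat) : Rvec R d := [tuple (if j == i then m.+1%:R^-1 else 0 : R) | j < d].
have eE m x : dot (e m) x = tnth x i / m.+1%:R.
  rewrite /dot (bigD1 i)//= tnth_mktuple eqxx big1 ?addr0 1?mulrC// => j ji.
  by rewrite tnth_mktuple (negbTE ji) mul0r.
apply: (@fourier_multiplier_cvg
  (fun m x => (0 < sin (dot (e m) x - a / m.+1%:R))%R%:R) _ 1).
- move=> m; apply: fourier_multiplier_gt0; first exact: fourier_multiplier_sin.
  by move=> x; exact: sin_max.
- by move=> m x; case: (_ < _); rewrite ?normr1 ?normr0.
move=> x; apply: cvg_near_cst.
near=> m; congr ((nat_of_bool _)%:R).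
rewrite eE -mulrBl.
set t := tnth x i - a.
(* Once the argument lies strictly between -pi and pi, its sine is positive exactly when t is. *)
have tpi : `|t / m.+1%:R| < pi.
  rewrite normrM normfV [`|m.+1%:R|]ger0_norm// ltr_pdivrMr//.
  rewrite -ltr_pdivrMl ?pi_gt0//.
  near: m.
  have [N _ HN] := nbhs_infty_gtr (pi^-1 * `|t|).
  exists N => // m /= Nm; apply: lt_le_trans (HN _ Nm) _.
  by rewrite ler_nat.
move: tpi; rewrite ltr_norml => /andP[t1 t2].
rewrite -[in RHS]subr_gt0 -/t.
have [t0|t0] := ltP 0 t.
  by apply: sin_gt0_pi; rewrite ?divr_gt0//.
apply/negbTE; rewrite -leNgt -oppr_ge0 -sinN; apply: sin_ge0_pi.
by rewrite oppr_ge0 mulr_le0_ge0//= lerNl ltW.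
Unshelve. all: by end_near. Qed.

Lemma fourier_multiplier_setC (A : set (Rvec R d)) : fourier_multiplier (\1_A) ->
  fourier_multiplier (\1_(~` A)).
Proof.
move=> AP; have := fourier_multiplier_lin 1 (-1) fourier_multiplier1 AP.
rewrite (_ : (fun x => _) = \1_(~` A))//; apply/funext => x.
by rewrite !indicE in_setC; case: (x \in A); rewrite !mul1r ?mulr1 ?mulr0 ?subrr ?addr0.
Qed.

(** By De Morgan it suffices to treat an intersection of complements, whose indicator is a limit of
    finite products that are eventually constant at each point. *)
Lemma fourier_multiplier_bigcup (F : nat -> set (Rvec R d)) :
  (forall n, fourier_multiplier (\1_(F n))) ->
  fourier_multiplier (\1_(\bigcup_n F n)).
Proof.
move=> FP; rewrite -[X in \1_X]setCK; apply: fourier_multiplier_setC.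
apply: (@fourier_multiplier_cvg (fun n x => \prod_(k < n) \1_(~` F k) x) _ 1).
- elim=> [|n IH].
    by under eq_fun do rewrite big_ord0; exact: fourier_multiplier1.
  under eq_fun do rewrite big_ord_recr/=.
  by apply: fourier_multiplierM IH _; exact: fourier_multiplier_setC.
- move=> n x; rewrite normr_prod; apply: prodr_ile1 => k _.
  by rewrite normr_ge0/= indicE; case: (_ \in _); rewrite ?normr1 ?normr0.
- move=> x; have [[n _ Fnx]|nF] := pselect ((\bigcup_n F n) x).
    rewrite indicE memNset; last by apply; exists n.
    apply: cvg_near_cst; exists n.+1 => // m /= nm.
    rewrite (bigD1 (Ordinal nm))//= indicE memNset ?mul0r//; exact.
  rewrite indicE mem_set//.
  apply: cvg_near_cst; apply: nearW => n; rewrite big1// => k _.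
  by rewrite indicE mem_set// => Fkx; apply: nF; exists k.
Qed.

Lemma fourier_multiplier_indic (A : set (Rvec R d)) : measurable A ->
  fourier_multiplier (\1_A).
Proof.
(* Stated for preimages under any map because it serves twice: with the identity, for the sets of
   tuples, and with each coordinate, for the Borel sets of the line. *)
have sT (T : Type) (f : Rvec R d -> T) :
   sigma_algebra setT [set B : set T | fourier_multiplier (\1_(f @^-1` B))].
  split => /=.
  - rewrite preimage_set0.
    have -> : \1_set0 = (fun=> 0) :> (Rvec R d -> R).
      by apply/funext => x; rewrite indicE in_set0.
    exact: fourier_multiplier_cst.
  - by move=> B; rewrite setTD preimage_setC; exact: fourier_multiplier_setC.
  - by move=> F FP; rewrite preimage_bigcup; exact: fourier_multiplier_bigcup.
suff : measurable `<=` [set B : set (Rvec R d) | fourier_multiplier (\1_B)] by exact.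
apply: smallest_sub; first exact: (sT _ id).
apply: (big_ind (fun S => S `<=` _)) => [//|S1 S2 h1 h2|i _].
  by rewrite subUset.
move=> _ [B mB <-] /=; rewrite setTI.
suff /(_ B mB) : measurable `<=` [set B : set (measurableTypeR R) |
    fourier_multiplier (\1_((fun x : Rvec R d => tnth x i) @^-1` B))] by [].
apply: smallest_sub; first exact: sT.
move=> _ [[a b] _ <-] /=.
(* The half-open intervals generate the Borel sets, and the indicator of a < x_i <= b is that of a <
   x_i times one minus that of b < x_i. *)
have := fourier_multiplierM (fourier_multiplier_coord_gt i a)
  (fourier_multiplier_lin 1 (-1) fourier_multiplier1 (fourier_multiplier_coord_gt i b)).
rewrite (_ : (fun x => _) = \1_((fun x : Rvec R d => tnth x i) @^-1` `]a, b]%classic))//.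
apply/funext => x; rewrite indicE.
have -> : (x \in (fun x : Rvec R d => tnth x i) @^-1` `]a, b]%classic) = (a < tnth x i <= b).
  by apply/idP/idP; rewrite inE/= in_itv/=.
by case: ltP => _ /=; case: ltP => _ /=;
  rewrite ?mul1r ?mul0r ?mulr1 ?addr0 ?subrr ?mulN1r ?subr0.
Qed.

Lemma fourier_inj w : fourier_null w -> {ae mu, forall x, w x = 0}.
Proof.
move=> w0; have [iw _] := w0.
have : ae_eq mu setT (EFin \o w) (cst 0%E).
  apply: (integral_ae_eq measurableT iw); first exact: measurable_cst.
  move=> E _ mE; rewrite integral0.
  have [_ _ /(_ w w0)] := fourier_multiplier_indic mE.
  (* At frequency 0 the cosine transform of w times the indicator of E is the integral of w over
     E. *)
  move=> /fourier_nullP[iwE /(_ [tuple 0 | _ < d]) + _].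
  rewrite /fourier_cos.
  have dot0 x : dot [tuple 0 | _ < d] x = 0.
    by rewrite /dot big1// => j _; rewrite tnth_mktuple mul0r.
  under eq_Rintegral do rewrite dot0 cos0 mulr1.
  rewrite /Rintegral => I0.
  rewrite integral_mkcond -[LHS]fineK; last first.
    by have := integrable_fin_num measurableT iwE; rewrite restrict_EFin; congr (_ \is a _);
     apply: eq_integral => x _ /=; rewrite patchE indicE; case: ifP; rewrite ?mulr1 ?mulr0.
  rewrite -[RHS]/((0:R)%:E) -I0; congr (fine _)%:E.
  by apply: eq_integral => x _ /=; rewrite patchE indicE; case: ifP; rewrite ?mulr1 ?mulr0.
by apply: filterS => x /(_ I) [].
Qed.

End fourier_injective.

(** * The series of convolution powers *)

Section convolution_powers_fourier.
Local Open Scope complex_scope.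
Variables (R : realType) (d : nat).
Local Notation mu := (lebesgue_Rvec R d).
Implicit Types (f g u w h : Rvec R d -> R) (k x y : Rvec R d).

Lemma convolution_ge0 f g : L1 f -> L1 g ->
  {ae mu, forall x, 0 <= f x} -> {ae mu, forall x, 0 <= g x} ->
  {ae mu, forall x, 0 <= convolution f g x}.
Proof.
move=> intf intg f0 g0.
have intc := L1_convolution intf intg; have mc := integrable_measurable intc.
(* By duality the integral of [f * g] over [A] is nonnegative. *)
pose A := [set x | convolution f g x < 0].
have mA : measurable A.
  rewrite (_ : A = convolution f g @^-1` `]-oo, 0[%classic); last first.
    by apply/seteqP; split => x /=; rewrite in_itv.
  by rewrite -[X in measurable X]setTI; exact: mc.
have mphi : measurable_fun setT (\1_A : Rvec R d -> R) by exact: measurable_indic.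
have phi1 x : `|\1_A x : R| <= 1 by rewrite indicE; case: (_ \in _); rewrite ?normr1 ?normr0.
have iAc : L1 (fun x => - (convolution f g x * \1_A x)).
  have := integrable_scale (-1) (integrableM_bound intc mphi phi1).
  by apply: eq_integrable => // x _ /=; rewrite mulN1r.
have : \int[mu]_x (- (convolution f g x * \1_A x)) = 0.
  apply/eqP; rewrite eq_le; apply/andP; split; last first.
    apply: Rintegral_ge0 => x _; rewrite indicE.
    have [/set_mem/= h|_] := boolP (x \in A); last by rewrite mulr0 oppr0.
    by rewrite mulr1 oppr_ge0 ltW.
  under eq_Rintegral do rewrite -mulN1r.
  rewrite RintegralZl//; last exact: integrableM_bound phi1.
  rewrite mulN1r oppr_le0 Rintegral_convolution//.
  have intW := integrableM_bound (integrable_convolution_kernel intf intg)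
    (measurableT_comp mphi measurable_fst) (fun p => phi1 p.1).
  apply: ae_Rintegral_ge0.
    have := measurable_Rintegral2 intW.
    congr measurable_fun; apply/funext => y; rewrite -RintegralZr//.
      by apply: eq_Rintegral => x _; rewrite mulrAC.
    exact: integrableM_bound (L1_shift y intf) mphi phi1.
  apply: filterS g0 => y gy; apply: mulr_ge0 => //.
  apply: ae_Rintegral_ge0.
    apply: measurable_funM => //.
    exact: integrable_measurable (L1_shift y intf).
  (* For fixed y the exceptional null set of f is merely translated; arguing pointwise in x would
     also reflect it. *)
  have [N [mN N0 fN]] := f0.
  exists ((fun x => vsub x y) @^-1` N); split.
  - by rewrite -[X in measurable X]setTI; exact: measurable_vsubr.
  - by rewrite -N0 -(lebesgue_Rvec_translate y).
  - move=> x /= nx; apply: fN => /= fx; apply: nx.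
    by rewrite indicE mulr_ge0.
move/(Rintegral_eq0_ae iAc).
have : {ae mu, forall x, 0 <= - (convolution f g x * \1_A x)}.
  apply: aeW => x; rewrite indicE.
  have [/set_mem/= h|_] := boolP (x \in A); last by rewrite mulr0 oppr0.
  by rewrite mulr1 oppr_ge0 ltW.
move=> /[swap] /[apply].
apply: filterS => x /eqP; rewrite oppr_eq0 mulf_eq0 indicE.
have [|/negP nA] := boolP (x \in A).
  by rewrite orbC /= pnatr_eq0/= => _ /eqP ->.
by move=> _; rewrite leNgt; apply/negP => h; apply: nA; rewrite inE.
Qed.

Lemma fourier0 f : fourier f [tuple 0 | _ < d] = (\int[mu]_x f x)%:C.
Proof.
have dot0 x : dot [tuple 0 | _ < d] x = 0.
  by rewrite /dot big1// => j _; rewrite tnth_mktuple mul0r.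
rewrite /fourier /fourier_cos /fourier_sin.
under eq_Rintegral do rewrite dot0 cos0 mulr1.
under [X in _ +i* X]eq_Rintegral do rewrite dot0 sin0 mulr0.
by congr (_ +i* _); rewrite /Rintegral integral0.
Qed.

Lemma iter_convolution_spec u n : L1 u -> {ae mu, forall x, 0 <= u x} ->
  [/\ L1 (iter_convolution n.+1 u), {ae mu, forall x, 0 <= iter_convolution n.+1 u x} &
    forall k, fourier (iter_convolution n.+1 u) k = fourier u k ^+ n.+1].
Proof.
move=> iu u0; elim: n => [|n [IH1 IH2 IH3]]; first by [].
rewrite /iter_convolution/= in IH1 IH2 IH3 *; split.
- exact: L1_convolution.
- exact: convolution_ge0.
- by move=> k; rewrite fourier_convolution// IH3 -exprS.
Qed.

(** The factor 1 gives the right-hand side the shape of [integrable_lin] and [fourier_lin]. *)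
Lemma sqrt_seriesS u N : sqrt_series u N.+1 =
  (fun x => 1 * sqrt_series u N x +
    (2^-1 * (sqrt_coef R N.+1 * 4 ^+ N.+1)) * iter_convolution N.+1 u x).
Proof.
apply/funext => x; rewrite /sqrt_series big_nat_recr//= mulrDr mul1r; congr (_ + _).
by rewrite !mulrA.
Qed.

Lemma sqrt_series0 u : sqrt_series u 0 = (fun x => 0).
Proof. by apply/funext => x; rewrite /sqrt_series big_geq// mulr0. Qed.

Lemma L1_0 : L1 (fun _ : Rvec R d => 0).
Proof. exact: integrable0. Qed.

Lemma fourier_fun0 k : fourier (fun _ : Rvec R d => 0) k = 0.
Proof.
rewrite /fourier /fourier_cos /fourier_sin.
by congr (_ +i* _); under eq_Rintegral do rewrite mul0r; rewrite /Rintegral integral0.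
Qed.

Lemma L1_sqrt_series u N : L1 u -> {ae mu, forall x, 0 <= u x} ->
  L1 (sqrt_series u N).
Proof.
move=> iu u0; elim: N => [|N IH]; first by rewrite sqrt_series0; exact: L1_0.
have [iN _ _] := iter_convolution_spec N iu u0.
by rewrite sqrt_seriesS; exact: integrable_lin.
Qed.

(** The transform turns convolution powers into powers, so a partial sum becomes a Taylor polynomial
    of (1 - sqrt (1 - 4 z)) / 2 at z = u^; the integral is its value at frequency 0. *)
Lemma sqrt_series_spec u N : L1 u -> {ae mu, forall x, 0 <= u x} ->
  [/\ L1 (sqrt_series u N),
    \int[mu]_x sqrt_series u N x = (1 - (sqrt_poly R N).[4 * \int[mu]_x u x]) / 2 &
    forall k, fourier (sqrt_series u N) k =
      (1 - (map_poly (real_complex R) (sqrt_poly R N)).[4 * fourier u k]) / 2].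
Proof.
move=> iu u0; have L1N M := L1_sqrt_series M iu u0.
have FN k : fourier (sqrt_series u N) k =
      (1 - (map_poly (real_complex R) (sqrt_poly R N)).[4 * fourier u k]) / 2.
  elim: N => [|N IH].
    rewrite sqrt_series0 fourier_fun0 /sqrt_poly poly_def big_ord1/= scale1r.
    by rewrite expr0 map_polyC/= hornerC subrr mul0r.
  have [iN _ FN] := iter_convolution_spec N iu u0.
  rewrite sqrt_seriesS fourier_lin// FN IH.
  have -> : sqrt_poly R N.+1 = sqrt_poly R N - (sqrt_coef R N.+1)%:P * 'X^(N.+1).
    rewrite /sqrt_poly !poly_def big_ord_recr/=; congr (_ + _).
    by rewrite scaleNr -mul_polyC.
  move: (sqrt_coef R N.+1) => c.
  have -> : (2^-1 * (c * 4 ^+ N.+1))%:C = 2^-1 * (c%:C * 4 ^+ N.+1) :> R[i].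
    by rewrite rmorphM rmorphM fmorphV rmorphXn !rmorph_nat.
  rewrite rmorphB rmorphM/= map_polyC/= map_polyXn.
  rewrite hornerD hornerN hornerM hornerC hornerXn exprMn.
  by field.
split=> //.
apply: complexI; rewrite -fourier0 FN fourier0.
have -> : 4 * (\int[mu]_x u x)%:C = (4 * \int[mu]_x u x)%:C.
  by rewrite rmorphM rmorph_nat.
by rewrite horner_map/= rmorphM rmorphB rmorph1 fmorphV rmorph_nat.
Qed.

Lemma L1_cvg_fourier (F : nat -> Rvec R d -> R) f k : L1_cvg F f ->
  fourier_cos (F N) k @[N --> \oo] --> fourier_cos f k /\
  fourier_sin (F N) k @[N --> \oo] --> fourier_sin f k.
Proof.
move=> [iF intf F0].
have F0' : fine (Lnorm mu 1%E (EFin \o (F N \- f))) @[N --> \oo] --> 0.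
  by apply: fine_cvg.
have iD N : L1 (F N \- f).
  have := integrable_lin 1 (-1) (iF N) intf.
  by apply: eq_integrable => // x _ /=; rewrite mul1r mulN1r.
have bound N (phi : Rvec R d -> R) : measurable_fun setT phi -> (forall x, `|phi x| <= 1) ->
    `| \int[mu]_x (F N x * phi x) - \int[mu]_x (f x * phi x)| <=
    fine (Lnorm mu 1%E (EFin \o (F N \- f))).
  move=> mphi phi1.
  have i1 := integrableM_bound (iF N) mphi phi1.
  have i2 := integrableM_bound intf mphi phi1.
  have i3 := integrableM_bound (iD N) mphi phi1.
  rewrite -RintegralB//.
  under eq_Rintegral do rewrite -mulrBl.
  rewrite (le_trans (le_normr_Rintegral measurableT i3))// Lnorm1.
  rewrite -[leRHS]/(\int[mu]_x `|F N x - f x|).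
  apply: ae_le_Rintegral; [exact: (integrable_norm i3)|exact: (integrable_norm (iD N))|].
  by apply: aeW => x; rewrite normrM ler_piMr.
split; apply/cvgrPdist_le => e e0.
  have /cvgrPdist_le /(_ e e0) := F0'; apply: filterS => N.
  rewrite sub0r normrN => h; rewrite distrC.
  apply: le_trans (bound N _ (measurable_cos_dot k) _) _; first by move=> x; exact: cos_max.
  exact: le_trans (ler_norm _) h.
have /cvgrPdist_le /(_ e e0) := F0'; apply: filterS => N.
rewrite sub0r normrN => h; rewrite distrC.
apply: le_trans (bound N _ (measurable_sin_dot k) _) _; first by move=> x; exact: sin_max.
exact: le_trans (ler_norm _) h.
Qed.

(** With a, b the two parts of the transform and r its modulus, r ^ 2 is the integral of f (a cos +
    b sin), and by Lagrange's identity this weight is at most r in absolute value. *)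
Lemma norm_fourier_le f k : L1 f -> `|fourier f k| <= (\int[mu]_x `|f x|)%:C.
Proof.
move=> intf; rewrite normc_def /= lecR.
set a := fourier_cos f k; set b := fourier_sin f k.
set r := Num.sqrt _.
have r0 : 0 <= r by exact: sqrtr_ge0.
have r2 : r ^+ 2 = a ^+ 2 + b ^+ 2 by rewrite sqr_sqrtr// addr_ge0 ?sqr_ge0.
have [->|rn0] := eqVneq r 0; first by apply: Rintegral_ge0.
have rgt0 : 0 < r by rewrite lt0r rn0.
suff : r * r <= r * \int[mu]_x `|f x| by rewrite ler_pM2l.
have ic := L1_cos k intf; have is_ := L1_sin k intf.
have -> : r * r = \int[mu]_x (a * (f x * cos (dot k x)) + b * (f x * sin (dot k x))).
  by rewrite Rintegral_lin// -expr2 r2.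
have inf := integrable_norm intf.
rewrite -RintegralZl//.
apply: ae_le_Rintegral; [exact: integrable_lin|exact: integrable_scale|].
apply: aeW => x.
set c := cos _; set s := sin _.
rewrite (_ : _ + _ = f x * (a * c + b * s)); last by ring.
rewrite (le_trans (ler_norm _))// normrM mulrC ler_wpM2r//.
rewrite -(ger0_norm r0) -ler_sqr ?nnegrE// !real_normK ?num_real// r2.
rewrite -[leRHS]mulr1 -(cos2Dsin2 (dot k x)) -/c -/s -subr_ge0.
by rewrite (_ : _ - _ = (a * s - b * c) ^+ 2) ?sqr_ge0//; ring.
Qed.

Lemma sqrt_series_cvg u : L1 u -> {ae mu, forall x, 0 <= u x} ->
  \int[mu]_x u x <= 1 / 4 ->
  exists2 f, L1_cvg (sqrt_series u) f & forall x, 0 <= f x.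
Proof.
move=> iu u0 b4; set b := \int[mu]_x u x.
have b0 : 0 <= b by apply: ae_Rintegral_ge0 => //; exact: (integrable_measurable iu).
have itP n := iter_convolution_spec n iu u0.
(* The absolute values make these sums increase at every point, as monotone convergence requires;
   almost everywhere they agree with [sqrt_series]. *)
pose S N x : R := 2^-1 * \sum_(1 <= n < N.+1)
  sqrt_coef R n * 4 ^+ n * `|iter_convolution n u x|.
have mS N : measurable_fun setT (S N).
  apply: measurable_funM; first exact: measurable_cst.
  rewrite /S; under eq_fun do rewrite big_add1/= big_mkord.
  apply: measurable_sum => n; apply: measurable_funM; first exact: measurable_cst.
  apply: measurableT_comp => //.
  by have [itn _ _] := itP n; exact: (integrable_measurable itn).
have S0 N x : 0 <= S N x.
  apply: mulr_ge0 => //; apply: sumr_ge0 => n _; apply: mulr_ge0 => //.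
  by apply: mulr_ge0; [exact: sqrt_coef_ge0|exact: exprn_ge0].
have ndS x : {homo (fun N => (S N x)%:E) : n m / (n <= m)%N >-> (n <= m)%E}.
  apply/nondecreasing_seqP => N; rewrite lee_fin /S ler_wpM2l// [leRHS]big_nat_recr//= lerDl.
  apply: mulr_ge0 => //.
  by apply: mulr_ge0; [exact: sqrt_coef_ge0|exact: exprn_ge0].
have SF : {ae mu, forall x, forall N, sqrt_series u N x = S N x}.
  have : {ae mu, forall x, forall n, 0 <= iter_convolution n.+1 u x}.
    by apply: ae_foralln => n; case: (itP n).
  apply: filterS => x itx N; rewrite /S /sqrt_series; congr (_ * _).
  rewrite !big_add1/= !big_mkord; apply: eq_bigr => n _.
  by rewrite ger0_norm.
pose g x := ereal_sup (range (fun N => (S N x)%:E)).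
have Sg x : (S N x)%:E @[N --> \oo] --> g x by exact: ereal_nondecreasing_cvgn.
have g0 x : (0 <= g x)%E.
  by apply: (@le_trans _ _ (S 0 x)%:E); [rewrite lee_fin|apply: ereal_sup_ubound; exists 0].
have mg : measurable_fun setT g.
  apply: (emeasurable_fun_cvg (fun N x => (S N x)%:E)) => [N|x _]; last exact: Sg.
  exact/measurable_EFinP.
(* The integral is (1 - P) / 2 with P a Taylor polynomial at 4 b; since 4 b <= 1, P is nonnegative
   there. *)
have IS N : (\int[mu]_x (S N x)%:E <= (1 / 2)%:E)%E.
  have [iF IF _] := sqrt_series_spec N iu u0.
  rewrite (ae_eq_integral (EFin \o sqrt_series u N)).
  - rewrite -[leLHS]fineK; last exact: integrable_fin_num.
    rewrite lee_fin -[leLHS]/(\int[mu]_x sqrt_series u N x) IF.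
    rewrite ler_pM2r// gerBl horner_sqrt_poly_ge0// ger0_norm ?mulr_ge0//.
    by move: b4; rewrite -/b; lra.
  - exact: measurableT.
  - exact/measurable_EFinP.
  - exact: measurable_int iF.
  - by apply: filterS SF => x h _ /=; rewrite h.
have ig : mu.-integrable setT g.
  apply/integrableP; split=> //.
  under eq_integral do rewrite gee0_abs//.
  have mSE N : measurable_fun setT (EFin \o S N) by exact/measurable_EFinP.
  have S0E N x : setT x -> (0 <= (EFin \o S N) x)%E by rewrite lee_fin.
  have ndSE x : setT x ->
      {homo (fun N => (EFin \o S N) x) : n m / (n <= m)%N >-> (n <= m)%E}.
    by move=> _; exact: ndS.
  have H := @cvg_monotone_convergence _ _ _ mu setT measurableT _ mSE S0E ndSE.
  have -> : (\int[mu]_x g x)%E = (\int[mu]_x limn (fun N => (EFin \o S N) x))%E.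
    by apply: eq_integral => x _; apply/esym/cvg_lim => //; exact: Sg.
  rewrite -(cvg_lim _ H)//.
  apply: (@le_lt_trans _ _ (1 / 2)%:E); last exact: ltry.
  apply: lime_le; last by apply: nearW => N; exact: IS.
  apply: ereal_nondecreasing_is_cvgn; apply/nondecreasing_seqP => N.
  apply: ge0_le_integral => // x _; first exact: S0E.
  exact: ndS.
(* Where the supremum is infinite, which happens on a null set only, [fine] returns 0; hence f is
   nonnegative everywhere. *)
pose f x := fine (g x).
have f0 x : 0 <= f x by exact: fine_ge0.
have mf : measurable_fun setT f by exact: (measurableT_comp (fine_measurable measurableT) mg).
have intf : L1 f.
  apply: (le_integrable measurableT _ _ ig); first exact/measurable_EFinP.
  move=> x _ /=; rewrite gee0_abs// ger0_norm// /f.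
  by case: (g x) (g0 x) => //= ; rewrite ?leey.
have gfin : {ae mu, forall x, g x \is a fin_num}.
  by apply: filterS (integrable_ae measurableT ig) => x /(_ I).
have iF N : L1 (sqrt_series u N) by case: (sqrt_series_spec N iu u0).
have [||||_ F0 _] := @Rintegral_dominated _ _ _ mu (sqrt_series u) f f _ mf.
- by move=> N; exact: integrable_measurable (iF N).
- apply: filterS2 gfin SF => x gx Fx; under eq_fun do rewrite Fx.
  by have := Sg x; rewrite -(fineK gx) => h; exact: (fine_cvg h).
- exact: intf.
- apply: filterS2 gfin SF => x gx Fx N; rewrite Fx ger0_norm//.
  by rewrite -lee_fin /f fineK//; apply: ereal_sup_ubound; exists N.
exists f => //; split=> //.
by under eq_fun do rewrite Lnorm1.
Qed.

End convolution_powers_fourier.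

(** * Uniqueness *)

Lemma sin_eq0_nat (R : realType) (y : R) : 0 <= y -> sin y = 0 ->
  exists n : nat, y = n%:R * pi.
Proof.
move=> y0.
have [n] : exists n : nat, y < n.+1%:R * pi.
  have [N _ HN] := nbhs_infty_gtr (y / pi).
  exists N; rewrite -ltr_pdivrMr ?pi_gt0//.
  by apply: HN => /=.
elim: n y y0 => [|n IH] y y0 yn sy.
  exists 0%N; rewrite mul0r; apply/eqP; rewrite eq_le y0 andbT leNgt; apply/negP => yp.
  by have := @sin_gt0_pi R y; rewrite yp sy ltxx -[pi]mul1r yn => /(_ isT).
have [yp|yp] := ltP y pi.
  exists 0%N; rewrite mul0r; apply/eqP; rewrite eq_le y0 andbT leNgt; apply/negP => y0'.
  by have := @sin_gt0_pi R y; rewrite y0' sy ltxx yp => /(_ isT).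
have [|||m ym] := IH (y - pi).
- by rewrite subr_ge0.
- by rewrite ltrBlDr (lt_le_trans yn)// -[n.+2%:R]natr1 mulrDl mul1r.
- by have := sinDpi (y - pi); rewrite subrK sy => /eqP; rewrite eq_sym oppr_eq0 => /eqP.
by exists m.+1; rewrite -natr1 mulrDl mul1r -ym subrK.
Qed.

Section rays.
Local Open Scope complex_scope.
Variables (R : realType) (d : nat).
Local Notation mu := (lebesgue_Rvec R d).
Implicit Types (f g u w h : Rvec R d -> R) (k x y : Rvec R d).

(** A cosine equal to 1 forces the sine to vanish, so the exceptional points lie on the countably
    many null hyperplanes where k.x is a multiple of pi. *)
Lemma cos_dot_lt1_ae k : (exists i, tnth k i != 0 :> R) ->
  {ae mu, forall x, cos (dot k x) < 1}.
Proof.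
move=> k0.
have mH b : measurable [set x | dot k x = b].
  rewrite (_ : mkset _ = dot k @^-1` [set b])// -[X in measurable X]setTI.
  exact: measurable_dot.
have N : mu.-negligible (\bigcup_n
    ([set x | dot k x = n%:R * pi] `|` [set x | dot k x = - (n%:R * pi)])).
  apply: negligible_bigcup => n; apply: negligibleU.
    by apply/negligibleP => //; exact: lebesgue_Rvec_hyperplane.
  by apply/negligibleP => //; exact: lebesgue_Rvec_hyperplane.
apply: negligibleS N => x /= /negP; rewrite -leNgt => c1.
have {}c1 : cos (dot k x) = 1.
  apply/eqP; rewrite eq_le c1 andbT.
  exact: le_trans (ler_norm _) (cos_max _).
have s0 : sin (dot k x) = 0 by apply: cos1sin0; rewrite c1 normr1.
have [x0|x0] := leP 0 (dot k x).
  by have [n xn] := sin_eq0_nat x0 s0; exists n => //; left.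
have [||n xn] := @sin_eq0_nat R (- dot k x).
- by rewrite oppr_ge0 ltW.
- by rewrite sinN s0 oppr0.
by exists n => //; right; rewrite /= -xn opprK.
Qed.

(* Averaging the identities [fourier_cos w (t k) = 1] against the weights
   [((1 + cos) / 2) ^ n] concentrates [w] on a null set. *)
Lemma fourier_cos_ray_neq1 w k : L1 w -> (exists i, tnth k i != 0 :> R) ->
  ~ (forall t : R, 0 < t -> \int[mu]_x (w x * cos (t * dot k x)) = 1).
Proof.
move=> iw k0 w1.
have mc (t : R) : measurable_fun setT (fun x => cos (t * dot k x)).
  apply: (measurableT_comp (continuous_measurable_fun (@continuous_cos R))).
  by apply: measurable_funM; [exact: measurable_cst|exact: measurable_dot].
have c1 (t : R) x : `|cos (t * dot k x)| <= 1 by exact: cos_max.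
pose q x := (1 + cos (dot k x)) / 2.
have mq : measurable_fun setT q.
  by apply: measurable_funM => //; apply: measurable_funD => //; exact: measurable_cos_dot.
have q01 x : 0 <= q x <= 1.
  have := cos_max (dot k x); rewrite ler_norml => /andP[? ?].
  by rewrite /q; apply/andP; split; lra.
have mqn n : measurable_fun setT (fun x => q x ^+ n) by exact: measurable_funX.
have qn1 n x : `|q x ^+ n| <= 1.
  by have /andP[q0 q1] := q01 x; rewrite normrX ger0_norm// exprn_ile1.
have iwq n (t : R) : L1 (fun x => w x * q x ^+ n * cos (t * dot k x)).
  exact: integrableM_bound (integrableM_bound iw (mqn n) (qn1 n)) (mc t) (c1 t).
(* Multiplication by q averages the frequencies t - 1, t, t + 1 with weights 1/4, 1/2, 1/4; the
   condition n < t keeps all frequencies positive through n averagings. *)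
have I1 n (t : R) : n%:R < t -> \int[mu]_x (w x * q x ^+ n * cos (t * dot k x)) = 1.
  elim: n t => [|n IH] t nt.
    by under eq_Rintegral do rewrite expr0 mulr1; exact: w1.
  rewrite -natr1 in nt.
  have i1 := integrable_lin (1 / 4) (1 / 4) (iwq n (t - 1)) (iwq n (t + 1)).
  transitivity (\int[mu]_x (1 / 2 * (w x * q x ^+ n * cos (t * dot k x)) +
      1 * (1 / 4 * (w x * q x ^+ n * cos ((t - 1) * dot k x)) +
           1 / 4 * (w x * q x ^+ n * cos ((t + 1) * dot k x))))).
    apply: eq_Rintegral => x _.
    by rewrite exprSr {2}/q [(t - 1) * _]mulrBl [(t + 1) * _]mulrDl !mul1r cosB cosD; field.
  rewrite (Rintegral_lin _ _ (iwq n t) i1).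
  rewrite (Rintegral_lin _ _ (iwq n (t - 1)) (iwq n (t + 1))) !IH; [by field|lra..].
(* At frequency n + 1 every integral is 1, while the integrands, dominated by |w|, tend to 0
   wherever q < 1, that is almost everywhere. *)
have [|||||_ _] := @Rintegral_dominated _ _ _ mu
  (fun n x => w x * q x ^+ n * cos (n.+1%:R * dot k x)) (fun=> 0) (fun x => `|w x|).
- by move=> n; exact: integrable_measurable (iwq n n.+1%:R).
- exact: measurable_cst.
- apply: filterS (cos_dot_lt1_ae k0) => x cx.
  have qx : `|q x| < 1.
    by have /andP[q0 q1] := q01 x; rewrite ger0_norm// /q; lra.
  have /cvgrPdist_le q0 := cvg_expr qx.
  apply/cvgrPdist_le => e e0.
  have e1 : 0 < e / (1 + `|w x|) by rewrite divr_gt0// ltr_pwDl.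
  apply: filterS (q0 _ e1) => n.
  rewrite !sub0r !normrN !normrM => h.
  rewrite ler_pdivlMr ?ltr_pwDl// in h.
  apply: le_trans h.
  have := c1 n.+1%:R x; have := normr_ge0 (w x); have := normr_ge0 (q x ^+ n).
  have := normr_ge0 (cos (n.+1%:R * dot k x)).
  set a := `|cos _|; set b := `|q x ^+ n|; set c := `|w x| => a0 b0 c0 a1.
  have : 0 <= b * c by exact: mulr_ge0.
  nra.
- exact: integrable_norm.
- apply: aeW => x n; rewrite !normrM -mulrA ler_piMr// mulr_ile1//.
rewrite [X in X @ _ --> _](_ : _ = fun=> 1); last first.
  by apply/funext => n; apply: I1; rewrite ltr_nat.
rewrite [X in _ --> X](_ : _ = 0); last by rewrite /Rintegral integral0.
move=> /(cvg_lim (@Rhausdorff R)); rewrite lim_cst// => /eqP.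
by rewrite oner_eq0.
Qed.

End rays.

Section uniqueness.
Local Open Scope complex_scope.
Variables (R : realType) (d : nat).
Local Notation mu := (lebesgue_Rvec R d).
Implicit Types (f g u w h : Rvec R d -> R) (k x y : Rvec R d).

Definition vscale (t : R) k : Rvec R d := [tuple (t * tnth k i : R) | i < d].

Lemma dot_vscale t k x : dot (vscale t k) x = t * dot k x.
Proof.
by rewrite /dot mulr_sumr; apply: eq_bigr => i _; rewrite tnth_mktuple mulrA.
Qed.

Lemma Rintegral_ray_continuous w k (phi : R -> R) : L1 w -> continuous phi ->
  (forall s, `|phi s| <= 1) ->
  continuous (fun t : R => \int[mu]_x (w x * phi (dot (vscale t k) x))).
Proof.
move=> iw cphi phi1 t.
have mphi s : measurable_fun setT (fun x => phi (dot (vscale s k) x)).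
  exact: (measurableT_comp (continuous_measurable_fun cphi) (measurable_dot _)).
have := @continuity_under_integral R _ _ mu (fun t x => w x * phi (dot (vscale t k) x))
  setT measurableT (t - 1) (t + 1) _ _ (fun x => `|w x|) _ _.
apply.
- by move=> s _; exact: integrableM_bound iw (mphi s) _.
- apply: aeW => x _ s _; apply: continuousM; first exact: cvg_cst.
  rewrite (_ : (fun t0 => _) = phi \o (fun s : R => s * dot k x)); last first.
    by apply/funext => r /=; rewrite dot_vscale.
  apply: continuous_comp; last exact: cphi.
  by apply: continuousM; [exact: cvg_id|exact: cvg_cst].
- exact: integrable_norm.
- by move=> s _; apply: aeW => x _; rewrite normrM ler_piMr.
by rewrite inE/= in_itv/=; apply/andP; split; lra.
Qed.

Lemma fourier_cos_continuous w k : L1 w ->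
  continuous (fun t : R => fourier_cos w (vscale t k)).
Proof.
move=> iw; apply: Rintegral_ray_continuous => //; last exact: cos_max.
exact: continuous_cos.
Qed.

Lemma fourier_sin_continuous w k : L1 w ->
  continuous (fun t : R => fourier_sin w (vscale t k)).
Proof.
move=> iw; apply: Rintegral_ray_continuous => //; last exact: sin_max.
exact: continuous_sin.
Qed.

(** Equality would make the nonnegative function u (1 - cos) vanish almost everywhere, hence u too,
    as the cosine is almost everywhere below 1. *)
Lemma fourier_cos_lt u k : L1 u -> {ae mu, forall x, 0 <= u x} ->
  (exists i, tnth k i != 0 :> R) -> 0 < \int[mu]_x u x ->
  fourier_cos u k < \int[mu]_x u x.
Proof.
move=> iu u0 k0 Iu.
have ic := L1_cos k iu.
have id_ := integrable_lin 1 (-1) iu ic.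
have d0 : {ae mu, forall x, 0 <= 1 * u x + -1 * (u x * cos (dot k x))}.
  apply: filterS u0 => x ux; rewrite mul1r mulN1r subr_ge0 ler_piMr//.
have Id : \int[mu]_x (1 * u x + -1 * (u x * cos (dot k x))) =
    \int[mu]_x u x - fourier_cos u k.
  by rewrite Rintegral_lin// mul1r mulN1r.
rewrite -subr_gt0 -Id lt_neqAle eq_sym; apply/andP; split; last first.
  exact: ae_Rintegral_ge0 (integrable_measurable id_) d0.
apply/eqP => I0.
have u00 : {ae mu, forall x, u x = 0}.
  apply: filterS2 (cos_dot_lt1_ae k0) (Rintegral_eq0_ae id_ d0 I0) => x cx.
  rewrite mul1r mulN1r => /eqP; rewrite -[X in X - _]mulr1 -mulrBr mulf_eq0.
  by rewrite [X in _ || X]subr_eq0 [1 == _]gt_eqF// orbF => /eqP.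
move: Iu; rewrite (ae_eq_Rintegral (integrable_measurable iu)
  (@measurable_cst _ _ _ _ setT (0 : R)) u00).
by rewrite /Rintegral integral0 ltxx.
Qed.

Lemma fourier_cos_lt_quarter u k : L1 u -> {ae mu, forall x, 0 <= u x} ->
  (exists i, tnth k i != 0 :> R) -> \int[mu]_x u x <= 1 / 4 ->
  fourier_cos u k < 1 / 4.
Proof.
move=> iu u0 k0 b4.
(* When u has no mass the comparison of the integrals need not be strict, but 0 < 1/4 is. *)
have [Iu|Iu] := ltP 0 (\int[mu]_x u x).
  exact: lt_le_trans (fourier_cos_lt iu u0 k0 Iu) b4.
apply: (@le_lt_trans _ _ (\int[mu]_x u x)); last by lra.
apply: ae_le_Rintegral => //; first exact: L1_cos.
apply: filterS u0 => x ux; rewrite ler_piMr//.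
Qed.

Lemma fourier_unique f g u : (1 <= d)%N -> L1 f -> L1 g -> L1 u ->
  {ae mu, forall x, 0 <= u x} -> \int[mu]_x u x <= 1 / 4 ->
  (forall k, fourier f k - fourier f k ^+ 2 = fourier u k) ->
  (forall k, fourier g k - fourier g k ^+ 2 = fourier u k) ->
  forall k, fourier f k = fourier g k.
Proof.
move=> d1 intf intg iu u0 b4 fE gE.
(* [A] and [B] are the squared moduli of the two factors of
   [(f^ - g^) (1 - f^ - g^) = 0]. *)
pose A k := (fourier_cos f k - fourier_cos g k) ^+ 2 +
            (fourier_sin f k - fourier_sin g k) ^+ 2.
pose B k := (1 - (fourier_cos f k + fourier_cos g k)) ^+ 2 +
            (fourier_sin f k + fourier_sin g k) ^+ 2.
have AP k : A k = 0 -> fourier f k = fourier g k.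
  move=> /eqP; rewrite paddr_eq0 ?sqr_ge0// !sqrf_eq0 !subr_eq0 => /andP[/eqP h1 /eqP h2].
  by rewrite /fourier h1 h2.
have AB k : A k * B k = 0.
  have := gE k; rewrite -(fE k) => /eqP; rewrite -subr_eq0.
  rewrite (_ : _ - _ = (fourier g k - fourier f k) * (1 - (fourier f k + fourier g k))); last by ring.
  rewrite mulf_eq0 => /orP[] /eqP E.
    suff -> : A k = 0 by rewrite mul0r.
    move: E; rewrite /fourier => /eqP; rewrite subr_eq0 eq_complex/= => /andP[/eqP h1 /eqP h2].
    by rewrite /A h1 h2 !subrr expr0n addr0.
  suff -> : B k = 0 by rewrite mulr0.
  move: E; rewrite /fourier => /eqP; rewrite eq_complex/= => /andP[/eqP h1 /eqP h2].
  rewrite /B h1 expr0n add0r; apply/eqP; rewrite sqrf_eq0 -oppr_eq0; apply/eqP.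
  by move: h2; rewrite sub0r.
(* If A = B, both vanish because their product does; then f^ = g^ = 1/2 and u^ = 1/4, which is
   excluded away from the origin. *)
have AB0 k : (exists i, tnth k i != 0 :> R) -> A k - B k != 0.
  move=> k0; apply/eqP => /eqP; rewrite subr_eq0 => /eqP ABE.
  have := AB k; rewrite -ABE => /eqP; rewrite mulf_eq0 orbb => /eqP A0.
  move: ABE; rewrite A0 => /esym/eqP.
  rewrite paddr_eq0 ?sqr_ge0// !sqrf_eq0 subr_eq0 => /andP[/eqP h3 /eqP h4].
  move: A0 => /eqP; rewrite paddr_eq0 ?sqr_ge0// !sqrf_eq0 !subr_eq0.
  move=> /andP[/eqP h1 /eqP h2].
  have := fE k; rewrite /fourier => /eqP; rewrite eq_complex/= => /andP[/eqP + _].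
  have := fourier_cos_lt_quarter iu u0 k0 b4.
  have -> : fourier_sin f k = 0 by lra.
  have -> : fourier_cos f k = 1 / 2 by lra.
  by move=> + h; rewrite -h; lra.
have sq (phi psi : R -> R) : continuous phi -> continuous psi ->
    continuous (fun t => phi t ^+ 2 + psi t ^+ 2).
  by move=> cphi cpsi t; under eq_fun do rewrite !expr2; apply: cvgD;
    apply: cvgM; by [exact: cphi|exact: cpsi].
have cA k : continuous (fun t => A (vscale t k)).
  apply: sq => t; first by apply: cvgB; exact: fourier_cos_continuous.
  by apply: cvgB; exact: fourier_sin_continuous.
have cB k : continuous (fun t => B (vscale t k)).
  apply: sq => t; last by apply: cvgD; exact: fourier_sin_continuous.
  by apply: cvgB; [exact: cvg_cst|apply: cvgD; exact: fourier_cos_continuous].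
have vs0 (t : R) k : 0 < t -> (exists i, tnth k i != 0 :> R) ->
    exists i, tnth (vscale t k) i != 0 :> R.
  move=> t0 [i ki]; exists i; rewrite tnth_mktuple mulf_neq0// gt_eqF//.
have vs1 k : vscale 1 k = k.
  by apply: eq_from_tnth => i; rewrite tnth_mktuple mul1r.
have A_ge0 k : 0 <= A k by rewrite addr_ge0 ?sqr_ge0.
have B_ge0 k : 0 <= B k by rewrite addr_ge0 ?sqr_ge0.
(* On an open ray A - B is continuous and never 0, nonpositive where A vanishes and nonnegative
   where B does; a change of sign would contradict the intermediate value theorem. *)
have ivt k (s t : R) : (exists i, tnth k i != 0 :> R) -> 0 < s -> 0 < t ->
    A (vscale s k) = 0 -> A (vscale t k) = 0.
  move=> k0 s0 t0 As; apply/eqP; apply/negP => /negP At.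
  pose psi (r : R) := A (vscale r k) - B (vscale r k).
  have cpsi : continuous psi by move=> r; apply: cvgB; [exact: cA|exact: cB].
  have psis : psi s <= 0 by rewrite /psi As sub0r oppr_le0.
  have psit : 0 <= psi t.
    have /eqP := AB (vscale t k); rewrite mulf_eq0 (negbTE At) /psi => /eqP ->.
    by rewrite subr0.
  have [r r0 psir] : exists2 r, 0 < r & psi r = 0.
    have [st|/ltW ts] := leP s t.
      have [|r] := @IVT R psi s t 0 st (continuous_subspaceT cpsi).
        by rewrite ge_min psis le_max psit orbT.
      by rewrite in_itv/= => /andP[sr _] psir; exists r => //; exact: lt_le_trans sr.
    have [|r] := @IVT R psi t s 0 ts (continuous_subspaceT cpsi).
      by rewrite ge_min psis orbT le_max psit.
    by rewrite in_itv/= => /andP[sr _] psir; exists r => //; exact: lt_le_trans sr.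
  by have := AB0 _ (vs0 _ _ r0 k0); rewrite -/(psi r) psir eqxx.
have Ak k : (exists i, tnth k i != 0 :> R) -> A k = 0.
  move=> k0; apply/eqP; apply/negP => /negP A0.
  (* A is nonzero at parameter 1, hence on the whole ray; so B vanishes there and the cosine
     transform of f + g is constantly 1. *)
  have Bt t : 0 < t -> B (vscale t k) = 0.
    move=> t0; have /eqP := AB (vscale t k); rewrite mulf_eq0 => /orP[/eqP At|/eqP//].
    by move: A0; rewrite -(vs1 k) (ivt k t 1) ?eqxx.
  apply: (@fourier_cos_ray_neq1 R d (fun x => 1 * f x + 1 * g x) k) => //.
    exact: integrable_lin.
  move=> t t0; have := Bt t t0.
  move=> /eqP; rewrite paddr_eq0 ?sqr_ge0// !sqrf_eq0 subr_eq0 => /andP[/eqP E _].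
  rewrite [RHS]E /fourier_cos -RintegralD//; [|exact: L1_cos..].
  by apply: eq_Rintegral => x _; rewrite dot_vscale; ring.
move=> k; apply: AP.
have [k0|k0] := pselect (exists i, tnth k i != 0 :> R); first exact: Ak.
(* The origin is reached as the limit of e / (n + 1); the vector e is nonzero because the dimension
   is positive. *)
pose e : Rvec R d := [tuple 1 | _ < d].
have kE : k = vscale 0 e.
  apply: eq_from_tnth => i; rewrite !tnth_mktuple mul0r.
  by apply/eqP/negP => /negP ki; apply: k0; exists i.
have e0 : exists i, tnth e i != 0 :> R.
  by exists (Ordinal d1); rewrite tnth_mktuple oner_neq0.
rewrite kE.
have /(continuous_cvg _ (cA e 0)) := @cvg_harmonic R.
rewrite [X in X @ _ --> _](_ : _ = fun=> 0); last first.
  by apply/funext => n; apply: Ak; apply: vs0 => //=; rewrite /harmonic/= invr_gt0.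
by move=> /(cvg_lim (@Rhausdorff R)); rewrite lim_cst.
Qed.

End uniqueness.

(** * The equation satisfied by the series *)

Section series_equation.
Local Open Scope complex_scope.
Variable R : realType.

Lemma norm_horner_sqrt_rem_le N (z : R[i]) : `|z| <= 1 ->
  `|(map_poly (real_complex R) (sqrt_rem R N)).[z]| <= (N.+1%:R^-1)%:C.
Proof.
move=> z1; apply: (@le_trans _ _ ((sqrt_rem R N).[1])%:C); last by rewrite lecR sqrt_rem1.
rewrite (horner_coef_wide _ (_ : (size _ <= size (sqrt_rem R N))%N)); last first.
  exact: size_poly.
rewrite horner_coef rmorph_sum/= (le_trans (ler_norm_sum _ _ _))// ler_sum// => i _.
rewrite coef_map/= expr1n mulr1 normrM normrX.
rewrite ger0_norm ?lecR ?sqrt_rem_ge0// ler_piMr ?lecR ?sqrt_rem_ge0//.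
by rewrite exprn_ile1.
Qed.

Lemma normc_leP (z : R[i]) (r : R) : `|z| <= r%:C ->
  `|complex.Re z| <= r /\ `|complex.Im z| <= r.
Proof.
rewrite normc_def lecR => zr.
split; apply: le_trans zr; rewrite -sqrtr_sqr ler_wsqrtr//.
  by rewrite lerDl sqr_ge0.
by rewrite lerDr sqr_ge0.
Qed.

Lemma cvg_harmonic_eq0 (s : nat -> R) (l : R) : s N @[N --> \oo] --> l ->
  (forall N, `|s N| <= N.+1%:R^-1) -> l = 0.
Proof.
move=> sl sb; have s0 : s N @[N --> \oo] --> (0 : R).
  apply/cvgrPdist_le => e e0; near=> N; rewrite sub0r normrN.
  apply: (le_trans (sb N)); apply: ltW; near: N.
  exact: (near_infty_natSinv_lt (PosNum e0)).
exact: (cvg_unique (@Rhausdorff R) sl s0).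
Unshelve. all: by end_near. Qed.

Variable d : nat.
Local Notation mu := (lebesgue_Rvec R d).
Implicit Types (f g u w h : Rvec R d -> R) (k x y : Rvec R d).

Lemma sqrt_series_equation u f : L1 u -> {ae mu, forall x, 0 <= u x} ->
  \int[mu]_x u x <= 1 / 4 -> L1_cvg (sqrt_series u) f ->
  forall k, fourier f k - fourier f k ^+ 2 = fourier u k.
Proof.
move=> iu u0 b4 Ff k.
have [ca cb] := L1_cvg_fourier k Ff.
have u4 : `|4 * fourier u k| <= 1.
  rewrite normrM normr_nat.
  have Iu : \int[mu]_x `|u x| = \int[mu]_x u x.
    apply: ae_eq_Rintegral.
    - exact: integrable_measurable (integrable_norm iu).
    - exact: integrable_measurable iu.
    - by apply: filterS u0 => x ux; rewrite ger0_norm.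
  have := norm_fourier_le k iu; rewrite Iu => h.
  apply: (@le_trans _ _ (4 * (1 / 4)%:C)).
    by rewrite ler_pM2l//; apply: le_trans h _; rewrite lecR.
  by rewrite -[4 as X in X * _](rmorph_nat (real_complex R)) -rmorphM/= mulrCA divff// mulr1.
pose D N := fourier (sqrt_series u N) k - fourier (sqrt_series u N) k ^+ 2 - fourier u k.
(* For s = (1 - P) / 2 one has s - s ^ 2 = (1 - P ^ 2) / 4, and P ^ 2 is 1 - 4 u^ plus the
   remainder. *)
have DE N : D N = - (1 / 4) * (map_poly (real_complex R) (sqrt_rem R N)).[4 * fourier u k].
  have [_ _ FN] := sqrt_series_spec N iu u0.
  rewrite /D FN /sqrt_rem rmorphB rmorphXn rmorphB rmorph1/= map_polyX !hornerE.
  by field.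
have Dle N : `|D N| <= (N.+1%:R^-1)%:C.
  rewrite DE normrM; apply: le_trans (norm_horner_sqrt_rem_le N u4).
  rewrite ler_piMl// normrN ger0_norm ?divr_ge0// ler_pdivrMr// mul1r.
  by rewrite ler1n.
have ReE N : complex.Re (D N) = fourier_cos (sqrt_series u N) k -
   (fourier_cos (sqrt_series u N) k * fourier_cos (sqrt_series u N) k -
    fourier_sin (sqrt_series u N) k * fourier_sin (sqrt_series u N) k) - fourier_cos u k by [].
have ImE N : complex.Im (D N) = fourier_sin (sqrt_series u N) k -
   (fourier_cos (sqrt_series u N) k * fourier_sin (sqrt_series u N) k +
    fourier_sin (sqrt_series u N) k * fourier_cos (sqrt_series u N) k) - fourier_sin u k by [].
apply/eqP; rewrite -subr_eq0 eq_complex/=; apply/andP; split; apply/eqP.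
  apply: (@cvg_harmonic_eq0 (fun N => complex.Re (D N))).
    under eq_fun do rewrite ReE.
    apply: cvgB; last exact: cvg_cst.
    by apply: cvgB => //; apply: cvgB; apply: cvgM.
  by move=> N; case: (normc_leP (Dle N)).
apply: (@cvg_harmonic_eq0 (fun N => complex.Im (D N))).
  under eq_fun do rewrite ImE.
  apply: cvgB; last exact: cvg_cst.
  by apply: cvgB => //; apply: cvgD; apply: cvgM.
by move=> N; case: (normc_leP (Dle N)).
Qed.

(** The quadratic equation leaves two candidates for the integral; the limit of the partial sums at
    frequency 0 selects the smaller root. *)
Lemma Rintegral_sqrt_series u f : L1 u -> {ae mu, forall x, 0 <= u x} ->
  \int[mu]_x u x <= 1 / 4 -> L1_cvg (sqrt_series u) f ->
  \int[mu]_x f x = (1 - Num.sqrt (1 - 4 * \int[mu]_x u x)) / 2.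
Proof.
move=> iu u0 b4 Ff.
have b0 : 0 <= \int[mu]_x u x.
  by apply: ae_Rintegral_ge0 => //; exact: (integrable_measurable iu).
have cE w : fourier_cos w [tuple 0 | _ < d] = \int[mu]_x w x.
  by have := fourier0 w => -[].
have [c _] := L1_cvg_fourier [tuple 0 | _ < d] Ff.
rewrite cE in c; move: c; under eq_fun do rewrite cE.
have IF N : \int[mu]_x sqrt_series u N x = (1 - (sqrt_poly R N).[4 * \int[mu]_x u x]) / 2.
  by have [] := sqrt_series_spec N iu u0.
under eq_fun do rewrite IF.
move=> c; apply: (cvg_unique (@Rhausdorff R) c).
apply: cvgM; last exact: cvg_cst.
apply: cvgB; first exact: cvg_cst.
by apply: sqrt_poly_cvg; rewrite ger0_norm ?mulr_ge0//; lra.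
Qed.

Lemma L1_sub_convolution f : L1 f -> L1 (fun x => f x - convolution f f x).
Proof.
move=> intf; have := integrable_lin 1 (-1) intf (L1_convolution intf intf).
by apply: eq_integrable => // x _ /=; rewrite mul1r mulN1r.
Qed.

Lemma fourier_sub_convolution f k : L1 f ->
  fourier (fun x => f x - convolution f f x) k = fourier f k - fourier f k ^+ 2.
Proof.
move=> intf; have := fourier_lin 1 (-1) k intf (L1_convolution intf intf).
rewrite rmorphN rmorph1 mul1r mulN1r fourier_convolution// -expr2 => <-.
by congr (fourier _ k); apply/funext => x; rewrite mul1r mulN1r.
Qed.

Lemma Rintegral_sub_convolution f : L1 f ->
  \int[mu]_x (f x - convolution f f x) =
  \int[mu]_x f x - (\int[mu]_x f x) ^+ 2.
Proof.
move=> intf; apply: complexI.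
by rewrite -fourier0 fourier_sub_convolution// fourier0 rmorphB rmorphXn.
Qed.

Lemma fourier_eq_ae f g : L1 f -> L1 g -> (forall k, fourier f k = fourier g k) ->
  {ae mu, forall x, f x = g x}.
Proof.
move=> intf intg fg.
have : {ae mu, forall x, 1 * f x + -1 * g x = 0}.
  apply: fourier_inj; split; first exact: integrable_lin.
  by move=> k; rewrite fourier_lin// fg rmorphN rmorph1 mul1r mulN1r subrr.
by apply: filterS => x /eqP; rewrite mul1r mulN1r subr_eq0 => /eqP.
Qed.

End series_equation.

Theorem theorem1 (R : realType) (d : nat) (d_ge1 : (1 <= d)%N) :
  let mu := lebesgue_Rvec R d in
  let c := sqrt_coef R in
  [/\ forall n, (1 <= n)%N -> 0 <= c n,
      forall n, (1 <= n)%N ->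
        c n = - (derive1n n (fun x : R => Num.sqrt (1 - x)) 0 / n`!%:R),
      forall x : R, `|x| <= 1 ->
        1 - \sum_(1 <= n < N.+1) c n * x ^+ n @[N --> \oo] --> Num.sqrt (1 - x)
    & exists2 K : R, 0 < K & c ~_\oo (fun n => K * n%:R `^ (- (3 / 2)))]
  /\
  (forall f : Rvec R d -> R, L1 f ->
    let u := fun x => f x - convolution f f x in
    {ae mu, forall x, 0 <= u x} ->
    [/\ \int[mu]_x f x <= 1 / 2,
        L1_cvg (sqrt_series u) f
      & {ae mu, forall x, 0 <= f x}])
  /\
  (forall u : Rvec R d -> R, L1 u ->
    {ae mu, forall x, 0 <= u x} ->
    \int[mu]_x u x <= 1 / 4 ->
    exists f : Rvec R d -> R,
      [/\ L1_cvg (sqrt_series u) f,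
          {ae mu, forall x, f x - convolution f f x = u x /\ 0 <= u x}
        & \int[mu]_x f x = 1 / 2 <-> \int[mu]_x u x = 1 / 4]).
Proof.
move=> mu c; split; last split.
- split.
  + by move=> n _; exact: sqrt_coef_ge0.
  + exact: sqrt_coef_derive1n.
  + move=> x x1; have := sqrt_poly_cvg x1.
    by under eq_fun do rewrite horner_sqrt_poly.
  + exact: sqrt_coef_equiv.
- move=> f intf u u0.
  have iu : L1 u by exact: L1_sub_convolution.
  have uE k : fourier f k - fourier f k ^+ 2 = fourier u k.
    by rewrite fourier_sub_convolution.
  have b4 : \int[mu]_x u x <= 1 / 4.
    rewrite Rintegral_sub_convolution// -/mu.
    by have := sqr_ge0 (\int[mu]_x f x - 1 / 2); lra.
  have [g Fg g0] := sqrt_series_cvg iu u0 b4.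
  have [iF intg F0] := Fg.
  have gE := sqrt_series_equation iu u0 b4 Fg.
  have fg : {ae mu, forall x, f x = g x}.
    exact: fourier_eq_ae intf intg (fourier_unique d_ge1 intf intg iu u0 b4 uE gE).
  split.
  + rewrite (ae_eq_Rintegral (integrable_measurable intf) (integrable_measurable intg) fg).
    rewrite (Rintegral_sqrt_series iu u0 b4 Fg).
    by have := sqrtr_ge0 (1 - 4 * \int[mu]_x u x); rewrite -/mu; lra.
  + split=> //.
    (* The convergence was proved towards g; the norms are the same for f, which agrees with g
       almost everywhere. *)
    suff -> : (fun N => Lnorm mu 1%E (EFin \o (sqrt_series u N \- f))) =
        (fun N => Lnorm mu 1%E (EFin \o (sqrt_series u N \- g))) by [].
    apply/funext => N.
    have mD (h : Rvec R d -> R) : L1 h ->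
        measurable_fun setT (fun x => `|(sqrt_series u N x - h x)%:E|%E).
      move=> ih; apply: measurableT_comp => //; apply/measurable_EFinP.
      by apply: measurable_funB;
        [exact: integrable_measurable (iF N)|exact: integrable_measurable ih].
    rewrite !Lnorm1; apply: ae_eq_integral => //.
    * exact: mD.
    * exact: mD.
    * by apply: filterS fg => x fgx _ /=; rewrite fgx.
  + by apply: filterS fg => x ->.
- move=> u iu u0 b4.
  have [f Ff f0] := sqrt_series_cvg iu u0 b4.
  have [iF intf F0] := Ff.
  exists f; split => //.
  + have : {ae mu, forall x, f x - convolution f f x = u x}.
      apply: fourier_eq_ae => //; first exact: L1_sub_convolution.
      move=> k; rewrite fourier_sub_convolution//.
      exact: (sqrt_series_equation iu u0 b4 Ff).
    by apply: filterS2 u0 => x ux fx; split.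
  + rewrite (Rintegral_sqrt_series iu u0 b4 Ff) -/mu; split=> h.
      have s0 : Num.sqrt (1 - 4 * \int[mu]_x u x) = 0 by lra.
      (* The square root is 0 on negative numbers, so its vanishing only yields 1 - 4 b <= 0; [b4]
         gives the other inequality. *)
      move/eqP: s0; rewrite sqrtr_eq0; lra.
    by rewrite h mulrCA divff// mulr1 subrr sqrtr0 subr0.
Qed.
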